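(* Assume that the super Poincaré inequality $$\mu(f^2)\le r\,\mathcal E(f)+\beta(r)\,\mu(|f|)^2,\qquad r>0,\ f\in\mathcal D(\mathcal E),$$ holds for some decreasing function $\beta:(0,\infty)\to(0,\infty)$. Assume also that there exists $k_0\ge 1$ such that $q(x,y)=0$ whenever $d(x,y)>k_0$. \begin{enumerate} \item[(1)] Suppose $\inf_{n\ge 1,\,k\ge k_0}\varepsilon_{n,k}(V)=0$. Then $$\mu_V(f^2)\le r\,\mathcal E_V(f)+\beta_V(r)\,\mu_V(|f|)^2,\qquad r>0,\ f\in\mathcal D(\mathcal E_V),$$ where $$\beta_V(r):=\inf\Big\{(1+8\lambda r')e^{J_{n,k}(V)}\beta(s):\ s>0,\ r'\in(0,r],\ n\ge1,\ k\ge k_0,\ 8\varepsilon_{n,k}(V)+s\,e^{K_{n,k}(V)}\le \frac{r'}{2+16\lambda r'}\Big\}.$$ \item[(2)] Suppose $\inf_{n\ge1,\,k\ge k_0}\varepsilon_{n,k}(V)<\infty$. Then there exist constants $C_1,C_2>0$ such that the defective Poincaré inequality $$\mu_V(f^2)\le C_1\,\mathcal E_V(f)+C_2\,\mu_V(|f|)^2,\qquad f\in\mathcal D(\mathcal E_V),$$ holds. \end{enumerate}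
   Context: Setting: $(E,d)$ is a Polish space with Borel $\sigma$-field and a probability measure $\mu$. Let $q:E\times E\to[0,\infty)$ be measurable with $q(x,x)=0$ for all $x$, and $$\lambda:=\sup_{x\in E}\int_E\big(1\wedge d(x,y)^2\big)q(x,y)\,\mu(\mathrm dy)<\infty.$$ For bounded measurable $f,g$ set $\Gamma(f,g)(x)=\int_E(f(x)-f(y))(g(x)-g(y))q(x,y)\mu(\mathrm dy)$ and $\Gamma(f)=\Gamma(f,f)$; let $\mathcal A$ be the set of bounded measurable $f$ with $\Gamma(f)$ bounded, assumed dense in $L^2(\mu)$. $(\mathcal E,\mathcal D(\mathcal E))$ is the closure in $L^2(\mu)$ of $\mathcal E(f,g)=\mu(\Gamma(f,g))$, $f,g\in\mathcal A$, and $\mathcal E(f)=\mathcal E(f,f)$. Fix $o\in E$ and set $\rho(x)=d(o,x)$. Let $V$ be a measurable function on $E$ which is bounded on each set $\{\rho\le r\}$, $r>0$, with $\mu(e^V)=1$; let $\mu_V(\mathrm dx)=e^{V(x)}\mu(\mathrm dx)$, and let $(\mathcal E_V,\mathcal D(\mathcal E_V))$ be the closure in $L^2(\mu_V)$ of $\mathcal E_V(f,g)=\mu_V(\Gamma(f,g))$, $f,g\in\mathcal A$, with $\mathcal E_V(f)=\mathcal E_V(f,f)$. Notation: $\beta^{-1}(s):=\inf\{r>0:\beta(r)\le s\}$ for $s>0$ (with $\inf\emptyset=\infty$). For integers $n,k\ge1$: $K_{n,k}(V)=\sup_{\rho(x)\le n+2}V(x)-\inf_{\rho(x)\le n+k+2}V(x)$,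 $J_{n,k}(V)=\sup_{\rho(x)\le n+1}V(x)-2\inf_{\rho(x)\le n+k+2}V(x)$, $\varepsilon_{n,k}(V)=\sup_{m\ge n}\big\{\beta^{-1}\big(1/[2\mu(\rho>m-1)]\big)e^{K_{m,k}(V)}\big\}$ (supremum over integers $m\ge n$). *)

(* Defs.v *)
From HB Require Import structures.
From mathcomp Require Import all_boot all_order all_algebra.
From mathcomp Require Import all_classical all_reals all_analysis.
Set Implicit Arguments. Unset Strict Implicit. Unset Printing Implicit Defensive.
Import Order.TTheory GRing.Theory Num.Theory.
Local Open Scope classical_set_scope.
Local Open Scope ring_scope.

Section Defs.
Context {R : realType} {dE : measure_display} {E : measurableType dE}.

Definition is_metric (dist : E -> E -> R) : Prop :=
  (forall x y, 0 <= dist x y) /\ (forall x y, dist x y = 0 <-> x = y) /\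
  (forall x y, dist x y = dist y x) /\
  (forall x y z, dist x z <= dist x y + dist y z).

Definition dopen (dist : E -> E -> R) (U : set E) : Prop :=
  forall x, U x -> exists2 eps : R, 0 < eps & forall y, dist x y < eps -> U y.

Definition dcomplete (dist : E -> E -> R) : Prop :=
  forall u : nat -> E,
    (forall eps : R, 0 < eps -> exists N, forall n m, (N <= n)%N -> (N <= m)%N ->
        dist (u n) (u m) < eps) ->
    exists x, forall eps : R, 0 < eps -> exists N, forall n, (N <= n)%N -> dist (u n) x < eps.

Definition dseparable (dist : E -> E -> R) : Prop :=
  exists u : nat -> E, forall x (eps : R), 0 < eps -> exists n, dist x (u n) < eps.

Definition borel_for (dist : E -> E -> R) : Prop :=
  (@measurable _ E) = <<s [set U | dopen dist U] >>.

Definition polish (dist : E -> E -> R) : Prop :=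
  [/\ is_metric dist, dcomplete dist, dseparable dist & borel_for dist].

Variables (mu : probability E R) (dist : E -> E -> R) (q : E -> E -> R).

Definition lam_e : \bar R :=
  ereal_sup [set (\int[mu]_y ((Num.min 1 (dist x y ^+ 2)) * q x y)%:E)%E | x in [set: E]].

Definition Gam (f : E -> R) (x : E) : \bar R :=
  (\int[mu]_y (((f x - f y) ^+ 2) * q x y)%:E)%E.

Definition inA (f : E -> R) : Prop :=
  [/\ measurable_fun setT f, (exists M : R, forall x, `|f x| <= M) &
      (exists M : R, forall x, (Gam f x <= M%:E)%E)].

Definition wint (w : E -> R) (g : E -> R) : \bar R :=
  (\int[mu]_x (w x * g x)%:E)%E.

Definition Eform (w : E -> R) (f : E -> R) : \bar R :=
  (\int[mu]_x ((w x)%:E * Gam f x))%E.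

Definition inL2 (w : E -> R) (f : E -> R) : Prop :=
  measurable_fun setT f /\ (wint w (fun x => f x ^+ 2)%R < +oo)%E.

(* closure_val w f e : f is in the domain of the closure in L^2(w mu) of the
   form E_w defined on A, and the closed form takes the value e at f. *)
Definition closure_val (w : E -> R) (f : E -> R) (e : R) : Prop :=
  inL2 w f /\
  exists fn : nat -> E -> R,
    [/\ forall n, inA (fn n),
        (fun n => wint w (fun x => (fn n x - f x) ^+ 2)) @ \oo --> 0%E,
        (forall eps : R, 0 < eps -> exists N, forall n m, (N <= n)%N -> (N <= m)%N ->
            (Eform w (fn n \- fn m)%R <= eps%:E)%E) &
        (fun n => Eform w (fn n)) @ \oo --> e%:E].

Variables (o : E) (V : E -> R) (beta : R -> R).

Definition rho (x : E) : R := dist o x.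

Definition wV (x : E) : R := expR (V x).

(* beta^{-1}(s) = inf {r > 0 : beta r <= s},  inf of empty set = +oo *)
Definition betainv (s : \bar R) : \bar R :=
  ereal_inf [set r%:E | r in [set r : R | 0 < r /\ ((beta r)%:E <= s)%E]].

Definition supV (a : R) : R := sup [set V x | x in [set x | rho x <= a]].
Definition infV (a : R) : R := inf [set V x | x in [set x | rho x <= a]].

Definition Knk (n k : nat) : R := supV (n%:R + 2) - infV (n%:R + k%:R + 2).
Definition Jnk (n k : nat) : R := supV (n%:R + 1) - 2 * infV (n%:R + k%:R + 2).

Definition tail_arg (m : nat) : \bar R :=
  let a := fine (mu [set x | m%:R - 1 < rho x]) in
  if a == 0 then +oo%E else ((2 * a)^-1)%:E.

Definition epsnk (n k : nat) : \bar R :=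
  ereal_sup [set (betainv (tail_arg m) * (expR (Knk m k))%:E)%E
            | m in [set m : nat | (n <= m)%N]].

Definition inf_eps (k0 : nat) : \bar R :=
  ereal_inf [set y | exists n k : nat, [/\ (1 <= n)%N, (k0 <= k)%N & y = epsnk n k]].

Definition betaV (k0 : nat) (r : R) : \bar R :=
  let lam := fine lam_e in
  ereal_inf [set y | exists (s r' : R) (n k : nat),
     [/\ [/\ 0 < s, 0 < r' <= r, (1 <= n)%N & (k0 <= k)%N],
         ((8%:E * epsnk n k + (s * expR (Knk n k))%:E)
            <= (r' / (2 + 16 * lam * r'))%:E)%E &
         y = ((1 + 8 * lam * r') * expR (Jnk n k) * beta s)%:E]].

End Defs.

(* Main.v *)
Require Import Defs.
From HB Require Import structures.
From mathcomp Require Import all_boot all_order all_algebra.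
From mathcomp Require Import all_classical all_reals all_analysis.
From mathcomp Require Import measurable_realfun zify lra ring.
Import Order.TTheory GRing.Theory Num.Theory.
Local Open Scope classical_set_scope.
Local Open Scope ring_scope.

(* Let [h_m] be the trapezoidal cutoff of [rho] equal to 1 on [m <= rho <= m + 1] and to 0
   outside [m - 1 < rho < m + 2].  By Cauchy-Schwarz, the super Poincare inequality applied to a
   function supported in [rho > m - 1] becomes a Poincare inequality with constant
   [2 b_m], where [b_m] is [betainv] at [1 / (2 mu (rho > m - 1))].  As [q] has range [k0], the
   energy of [f h_m] only sees [rho <= m + 2 + k0], so passing from [mu] to [mu_V] on both sides
   costs a factor [exp K_{m,k}].  At most three of the [h_m] overlap, so summing over [m >= n]
   bounds [mu_V (f^2; rho > n)] by [12 eps E_V f + 24 lam eps mu_V (f^2)]; the ball [rho <= n] is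
   handled by one cutoff and the super Poincare inequality itself, and the [mu_V (f^2)] terms are
   absorbed.

   When [eps] is merely finite, [24 lam eps] need not be small.  The offending term,
   [b_m exp (sup V) mu (f^2)] over the shells [j] within distance [k0 + 1] of [m], is then bounded
   by the Poincare inequality on those shells once more.  Only one of the two factors [b_m], [b_j]
   is spent on compensating [exp K], and the other tends to 0 because [mu (rho > m) -> 0], so
   absorption is possible again. *)

Set Implicit Arguments.
Unset Strict Implicit.
Unset Printing Implicit Defensive.

(** * Trapezoidal cutoffs on the line *)

Section cutoff.
Context {R : realType}.
Implicit Types a b s t : R.

Definition tent a b t : R := Num.max 0 (Num.min 1 (Num.min (t - a) (b - t))).

Lemma tent_ge0 a b t : 0 <= tent a b t.
Proof. by rewrite /tent le_max lexx. Qed.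

Lemma tent_le1 a b t : tent a b t <= 1.
Proof. by rewrite /tent ge_max ler01 ge_min lexx. Qed.

(** Each regime carries its range of [u], so that comparing two clamped values splits into cases
    that are all linear. *)
Lemma clampP (u : R) : [\/ u <= 0 /\ Num.max 0 (Num.min 1 u) = 0,
  0 <= u <= 1 /\ Num.max 0 (Num.min 1 u) = u |
  1 <= u /\ Num.max 0 (Num.min 1 u) = 1].
Proof.
have [u0|u0] := leP u 0.
  by apply: Or31; split=> //; rewrite min_r ?(le_trans u0)// max_l.
have [u1|u1] := leP u 1.
  by apply: Or32; rewrite (ltW u0) max_r// ltW.
by apply: Or33; rewrite max_r// ltW.
Qed.

Lemma tent_lip a b s t : `|tent a b s - tent a b t| <= `|s - t|.
Proof.
rewrite /tent; apply: (@le_trans _ _ `|Num.min (s - a) (b - s) - Num.min (t - a) (b - t)|).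
  set u := Num.min (s - a) _; set v := Num.min (t - a) _; rewrite ler_norml.
  have [uv|uv] := ger0P (u - v); case: (clampP u) => -[hu ->];
    case: (clampP v) => -[hv ->]; lra.
rewrite ler_norml; have [st|st] := ger0P (s - t);
  case: (leP (s - a) (b - s)) => ?; case: (leP (t - a) (b - t)) => ?; lra.
Qed.

Lemma tent_eq0 a b t : (t <= a) || (b <= t) -> tent a b t = 0.
Proof.
move=> h; rewrite /tent max_l// ge_min; apply/orP; right; rewrite ge_min.
by rewrite subr_le0 [b - t <= 0]subr_le0.
Qed.

Lemma tent_eq1 a b t : a + 1 <= t -> t <= b - 1 -> tent a b t = 1.
Proof.
by move=> ? ?; rewrite /tent min_l ?max_r// le_min; apply/andP; split; lra.
Qed.

Lemma measurable_tent a b : measurable_fun setT (tent a b).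
Proof.
apply: measurable_maxr => //; apply: measurable_minr => //.
by apply: measurable_minr; apply: measurable_funB.
Qed.

Lemma sumr_eqb_le1 (n N p : nat) : \sum_(n <= m < N) ((m == p)%:R : R) <= 1.
Proof.
have [pin|pin] := boolP (p \in index_iota n N).
  rewrite (bigD1_seq p)//= ?iota_uniq// eqxx big1 ?addr0//.
  by move=> i /negbTE ->.
rewrite big_seq big1// => i ii; case: eqP => // ip.
by move: pin; rewrite -ip ii.
Qed.

Lemma sumr_three_le (c : nat -> R) (B : R) (p n N : nat) :
  (forall m, 0 <= c m <= B) ->
  (forall m, c m != 0 -> [|| m.+1 == p, m == p | m == p.+1]) ->
  \sum_(n <= m < N) c m <= 3 * B.
Proof.
move=> cB cp.
have B0 : 0 <= B by have /andP[h1 h2] := cB 0%N; exact: le_trans h2.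
(* Every term is charged to one of the three admissible indices. For [p = 0] the index 0 is counted
   twice, which only enlarges the bound. *)
apply: (@le_trans _ _ (\sum_(n <= m < N)
    (B * (m == p.-1)%:R + B * (m == p)%:R + B * (m == p.+1)%:R))).
  apply: ler_sum => m _; have /andP[c0 cb] := cB m.
  have [->|/cp] := eqVneq (c m) 0; first by rewrite !addr_ge0 ?mulr_ge0.
  move=> h; apply: (le_trans cb); rewrite -!mulrDr -!natrD -[leLHS]mulr1.
  rewrite ler_wpM2l// ler1n !addn_gt0 !lt0b -orbA.
  by case/or3P: h => /eqP h; rewrite -h /= eqxx ?orbT.
rewrite !big_split/= -!mulr_sumr.
have := @sumr_eqb_le1 n N p; have := @sumr_eqb_le1 n N p.-1; have := @sumr_eqb_le1 n N p.+1.
by move=> h1 h2 h3; rewrite -!mulrDr mulrC ler_wpM2r//; lra.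
Qed.

Definition shell (m : nat) : R -> R := tent (m%:R - 1) (m%:R + 2).

(** The shell [m] vanishes outside the open interval from [m - 1] to [m + 2], so with [p] the
    integer part of [t] only [p - 1], [p] and [p + 1] can occur. Writing [m.+1 == p] leaves no
    spurious predecessor when [p = 0]. *)
Lemma shell_near t : 0 <= t -> exists p : nat, forall m : nat,
  shell m t != 0 -> [|| m.+1 == p, m == p | m == p.+1].
Proof.
move=> t0; exists (Num.truncn t) => m mt.
have /andP[h1 h2] := truncn_itv t0.
have [ml|/ltW ml] := leP t (m%:R - 1).
  by rewrite /shell tent_eq0 ?ml ?eqxx// in mt.
have [mu|/ltW mu] := leP (m%:R + 2) t.
  by rewrite /shell tent_eq0 ?mu ?orbT ?eqxx// in mt.
have a1 : (m < (Num.truncn t).+2)%N.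
  have [//|] := ltnP; rewrite -(ler_nat R) => h.
  rewrite /shell tent_eq0 ?eqxx// in mt; apply/orP; left.
  by move: h h2; rewrite -!natr1; lra.
have a2 : (Num.truncn t < m.+2)%N.
  have [//|] := ltnP; rewrite -(ler_nat R) => h.
  rewrite /shell tent_eq0 ?eqxx// in mt; apply/orP; right.
  by move: h h1; rewrite -!natr1; lra.
move: a1 a2; rewrite !ltnS; clear; move: (Num.truncn t) => p.
rewrite leq_eqVlt => /orP[/eqP->|]; first by rewrite eqxx !orbT.
rewrite ltnS leq_eqVlt => /orP[/eqP->|]; first by rewrite eqxx !orbT.
by move=> h1 h2; apply/orP; left; rewrite eqn_leq h1 h2.
Qed.

Lemma shell_sqr_overlap n N t : 0 <= t -> \sum_(n <= m < N) shell m t ^+ 2 <= 3.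
Proof.
move=> t0; have [p hp] := shell_near t0.
rewrite -[leRHS]mulr1; apply: (@sumr_three_le _ _ p) => m.
  by rewrite sqr_ge0/= expr_le1// ?tent_ge0 ?tent_le1.
by move=> h; apply: hp; apply: contra_neq h => ->; rewrite expr0n.
Qed.

(** At most three shells are nonzero at [s] and at most three at [t]. Each nonzero difference is
    charged to one of these two points, whence 6. *)
Lemma shell_diff_overlap n N s t c : 0 <= s -> 0 <= t ->
  (forall m, (shell m s - shell m t) ^+ 2 <= c) ->
  \sum_(n <= m < N) (shell m s - shell m t) ^+ 2 <= 6 * c.
Proof.
move=> s0 t0 hc; have c0 : 0 <= c by rewrite (le_trans _ (hc 0%N))// sqr_ge0.
have [p hp] := shell_near s0; have [p' hp'] := shell_near t0.
rewrite (@le_trans _ _ (\sum_(n <= m < N) (c * (shell m s != 0)%:R + c * (shell m t != 0)%:R)))//.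
  apply: ler_sum => m _; have [h1|h1] := eqVneq (shell m s) 0; last first.
    by rewrite mulr1 (le_trans (hc m))// lerDl mulr_ge0.
  have [h2|h2] := eqVneq (shell m t) 0; last by rewrite mulr0 add0r mulr1.
  by rewrite h1 h2 subr0 expr0n/= !mulr0 addr0.
have b (u : R) q : (forall m, shell m u != 0 -> [|| m.+1 == q, m == q | m == q.+1]) ->
    \sum_(n <= m < N) (c * (shell m u != 0)%:R) <= 3 * c.
  move=> hq; apply: (@sumr_three_le _ _ q) => m.
    by case: (_ != _); rewrite ?mulr1 ?mulr0 ?c0 ?lexx.
  by have [e|e _] := eqVneq (shell m u) 0; [rewrite mulr0 eqxx | exact: hq].
by rewrite big_split/=; have := b _ _ hp; have := b _ _ hp'; lra.
Qed.

End cutoff.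

(** * Weighted means of bounded functions *)

Section bounded_measurable.
Context {R : realType} {d : measure_display} {T : measurableType d}.
Implicit Types f g : T -> R.

Definition bmeas g : Prop :=
  measurable_fun setT g /\ exists M : R, forall x, `|g x| <= M.

Lemma bmeas_cst (c : R) : bmeas (fun=> c).
Proof. by split; [exact: measurable_cst | exists `|c|]. Qed.

Lemma bmeasD f g : bmeas f -> bmeas g -> bmeas (fun x => f x + g x).
Proof.
move=> [mf [M hM]] [mg [N hN]]; split; first exact: measurable_funD.
by exists (M + N) => x; rewrite (le_trans (ler_normD _ _))// lerD.
Qed.

Lemma bmeasM f g : bmeas f -> bmeas g -> bmeas (fun x => f x * g x).
Proof.
move=> [mf [M hM]] [mg [N hN]]; split; first exact: measurable_funM.
by exists (M * N) => x; rewrite normrM ler_pM.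
Qed.

Lemma bmeasZ (c : R) g : bmeas g -> bmeas (fun x => c * g x).
Proof. by move=> bg; apply: bmeasM => //; exact: bmeas_cst. Qed.

Lemma bmeasX n g : bmeas g -> bmeas (fun x => g x ^+ n).
Proof.
move=> bg; elim: n => [|n ih]; first exact: bmeas_cst.
by under eq_fun do rewrite exprS; exact: bmeasM.
Qed.

Lemma bmeas_norm g : bmeas g -> bmeas (fun x => `|g x|).
Proof.
move=> [mg [M hM]]; split; first exact: measurableT_comp.
by exists M => x; rewrite normr_id.
Qed.

Lemma bmeas_sum (I : Type) (s : seq I) (g : I -> T -> R) :
  (forall i, bmeas (g i)) -> bmeas (fun x => \sum_(i <- s) g i x).
Proof.
move=> bg; elim: s => [|i s ih].
  by under eq_fun do rewrite big_nil; exact: bmeas_cst.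
by under eq_fun do rewrite big_cons; exact: bmeasD.
Qed.

Lemma bmeas_ge (a : R) (r : T -> R) : measurable_fun setT r ->
  bmeas (fun x => (a <= r x)%R%:R).
Proof.
move=> mr; split; last by exists 1 => x; case: (a <= r x); rewrite ?normr1 ?normr0.
rewrite (_ : (fun x => _) = \1_(r @^-1` `[a, +oo[)); last first.
  apply/funext => x; rewrite indicE; congr (_%:R); congr nat_of_bool.
  by apply/idP/idP; rewrite inE /= in_itv/= andbT.
by apply: measurable_indic; rewrite -[X in measurable X]setTI; exact: mr.
Qed.

End bounded_measurable.

Section weighted_mean.
Context {R : realType} {d : measure_display} {T : measurableType d}.
Context (mu : probability T R) (w : T -> R).
Hypothesis mw : measurable_fun setT w.
Hypothesis w_ge0 : forall x, 0 <= w x.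
Hypothesis w1 : (\int[mu]_x (w x)%:E = 1)%E.
Implicit Types f g : T -> R.

(** Since [w] has mass one, weighted integrals of bounded functions are finite and the estimates can
    be carried out in [R]. An infinite integral would be sent to 0 by [fine]. *)
Definition wmean g : R := fine (wint mu w g).

Lemma integrable_weighted g : bmeas g ->
  mu.-integrable setT (EFin \o (fun x => w x * g x)).
Proof.
move=> [mg [M hM]].
rewrite (_ : _ \o _ = (EFin \o w) \* (EFin \o g))%E; last first.
  by apply/funext => x /=; rewrite EFinM.
apply: integrableMl => //.
  apply/integrableP; split; first exact/measurable_EFinP.
  under eq_integral do rewrite /= ger0_norm//.
  by rewrite w1 ltry.
exists M; split; first exact: num_real.
by move=> N MN x _; apply: (le_trans (hM x)); exact: ltW.
Qed.

Lemma wintE g : bmeas g -> wint mu w g = (wmean g)%:E.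
Proof.
by move=> bg; rewrite /wmean fineK//; apply: integrable_fin_num => //;
  exact: integrable_weighted.
Qed.

Lemma wmeanD f g : bmeas f -> bmeas g ->
  wmean (fun x => f x + g x) = wmean f + wmean g.
Proof.
move=> bf bg; apply: EFin_inj; rewrite EFinD -!wintE//; last exact: bmeasD.
rewrite /wint -integralD_EFin//; try exact: integrable_weighted.
by apply: eq_integral => x _; rewrite mulrDr EFinD.
Qed.

Lemma wmeanZ (c : R) g : bmeas g -> wmean (fun x => c * g x) = c * wmean g.
Proof.
move=> bg; apply: EFin_inj; rewrite EFinM -!wintE//; last exact: bmeasZ.
rewrite /wint -integralZl//; last exact: integrable_weighted.
by apply: eq_integral => x _; rewrite mulrCA EFinM.
Qed.

Lemma wmean_sum (I : Type) (s : seq I) (g : I -> T -> R) :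
  (forall i, bmeas (g i)) ->
  wmean (fun x => \sum_(i <- s) g i x) = \sum_(i <- s) wmean (g i).
Proof.
move=> bg; elim: s => [|i s ih].
  by rewrite big_nil /wmean /wint; under eq_integral do rewrite big_nil mulr0; rewrite integral0.
rewrite big_cons -ih -wmeanD//; last exact: bmeas_sum.
by under eq_fun do rewrite big_cons.
Qed.

Lemma le_wmean f g : bmeas f -> bmeas g -> (forall x, f x <= g x) ->
  wmean f <= wmean g.
Proof.
move=> bf bg fg; rewrite -lee_fin -!wintE//.
apply: le_integral => //; try exact: integrable_weighted.
by move=> x _; rewrite lee_fin ler_wpM2l.
Qed.

Lemma wmean_ge0 g : (forall x, 0 <= g x) -> 0 <= wmean g.
Proof.
by move=> g0; rewrite fine_ge0// integral_ge0// => x _; rewrite lee_fin mulr_ge0.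
Qed.

(** Dominated convergence with the weight as dominating function: at each point the indicator of
    [n <= r] is eventually 0. *)
Lemma wmean_tail (r : T -> R) (e : R) : measurable_fun setT r -> 0 < e ->
  exists N : nat, forall n : nat, (N <= n)%N ->
    wmean (fun x => (n%:R <= r x)%R%:R) <= e.
Proof.
move=> mr e0; pose B n x : R := (n%:R <= r x)%R%:R.
have bB n : bmeas (B n) := bmeas_ge n%:R mr.
have [|||||_ _] := @dominated_convergence _ _ _ mu setT measurableT
  (fun n x => (w x * B n x)%:E) (fun=> 0%E) (fun x => (w x * 1)%:E).
- by move=> n; apply/measurable_EFinP; apply: measurable_funM => //; case: (bB n).
- exact: measurable_cst.
- apply: aeW => x _; apply: cvg_near_cst.
  exists (Num.truncn (r x)).+1 => // n /= rn; rewrite /B.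
  have [nr|] := leP (n%:R) (r x); last by rewrite mulr0.
  have := lt_le_trans (truncnS_gt (r x)) (_ : (Num.truncn (r x)).+1%:R <= n%:R).
  by rewrite ler_nat => /(_ rn); rewrite ltNge nr.
- by apply: (@integrable_weighted (fun=> 1)); exact: bmeas_cst.
- apply: aeW => x n _; rewrite /= lee_fin ger0_norm ?mulr_ge0// ?ler0n//.
  by rewrite ler_wpM2l// /B; case: (n%:R <= r x).
rewrite integral0 => /fine_cvgP[_] /cvgrPdist_le /(_ e e0) [N _ hN].
exists N => n Nn; have := hN n Nn; rewrite /= sub0r normrN => h.
exact: le_trans (ler_norm _) h.
Qed.

End weighted_mean.

(** * The carre du champ of products with cutoffs *)

Section jump_form.
Context {R : realType} {dE : measure_display} {E : measurableType dE}.
Context (dist : E -> E -> R) (mu : probability E R).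
Hypothesis Edist : polish dist.

Lemma dopen_measurable (U : set E) : dopen dist U -> measurable U.
Proof.
by case: Edist => _ _ _ -> dU; exact: sub_gen_smallest.
Qed.

Lemma dist_ge0 x y : 0 <= dist x y.
Proof. by case: Edist => -[]. Qed.

Lemma dist_sym x y : dist x y = dist y x.
Proof. by case: Edist => -[_ [_ []]]. Qed.

Lemma dist_tri x y z : dist x z <= dist x y + dist y z.
Proof. by case: Edist => -[_ [_ []]]. Qed.

Lemma dist_diff o x y : `|dist o x - dist o y| <= dist x y.
Proof.
have := dist_tri o x y; have := dist_tri o y x; rewrite (dist_sym y x) ler_norml.
by move=> h1 h2; apply/andP; split; lra.
Qed.

Lemma measurable_dist x : measurable_fun setT (dist x).
Proof.
apply: (measurability _ (RGenOInfty.measurableE R)) => _ [_ [a ->] <-].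
rewrite setTI; apply: dopen_measurable => y /=; rewrite in_itv/= andbT => ay.
exists (dist x y - a); first by rewrite subr_gt0.
move=> z yz; rewrite /= in_itv/= andbT.
by have := dist_tri x z y; rewrite (dist_sym z y); lra.
Qed.

(** Working with nonnegative integrands in the extended reals avoids any integrability question. The
    list serves both single cutoffs, as a singleton, and sums over shells. *)
Lemma sum_integral_le (I : Type) (s : seq I) (F : I -> E -> R) (G H : E -> R)
    (a b : R) :
  (forall i y, 0 <= F i y) -> (forall y, 0 <= G y) -> (forall y, 0 <= H y) ->
  (forall i, measurable_fun setT (F i)) -> measurable_fun setT G ->
  measurable_fun setT H -> 0 <= a -> 0 <= b ->
  (forall y, \sum_(i <- s) F i y <= a * G y + b * H y) ->
  (\sum_(i <- s) \int[mu]_y (F i y)%:E <=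
     a%:E * \int[mu]_y (G y)%:E + b%:E * \int[mu]_y (H y)%:E)%E.
Proof.
move=> F0 G0 H0 mF mG mH a0 b0 FGH.
have mF' i : measurable_fun setT (EFin \o F i) by exact/measurable_EFinP.
have mG' : measurable_fun setT (EFin \o G) by exact/measurable_EFinP.
have mH' : measurable_fun setT (EFin \o H) by exact/measurable_EFinP.
rewrite -ge0_integral_sum// -?ge0_integralZl_EFin//; [|by move=> *; rewrite lee_fin..].
rewrite -ge0_integralD//; first last.
- exact: measurable_funeM.
- by move=> y _; rewrite -EFinM lee_fin mulr_ge0.
- exact: measurable_funeM.
- by move=> y _; rewrite -EFinM lee_fin mulr_ge0.
apply: ge0_le_integral => //.
- by move=> y _; rewrite sume_ge0// => i _; rewrite lee_fin.
- exact: emeasurable_sum.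
- by apply: emeasurable_funD; exact: measurable_funeM.
- by move=> y _; rewrite sumEFin -!EFinM -EFinD lee_fin.
Qed.

Section kernel.
Context (q : E -> E -> R).
Hypothesis mq : measurable_fun setT (fun p : E * E => q p.1 p.2).
Hypothesis q_ge0 : forall x y, 0 <= q x y.

(** This is the carré du champ only where [Gam] is finite, hence everywhere for [f] in [A]. *)
Definition gam (f : E -> R) (x : E) : R := fine (Gam mu q f x).

Lemma Gam_ge0 f x : (0 <= Gam mu q f x)%E.
Proof. by apply: integral_ge0 => y _; rewrite lee_fin mulr_ge0 ?sqr_ge0. Qed.

Lemma gam_ge0 f x : 0 <= gam f x.
Proof. by rewrite fine_ge0 ?Gam_ge0. Qed.

Lemma measurable_Gam f : measurable_fun setT f -> measurable_fun setT (Gam mu q f).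
Proof.
move=> mf; apply: (@measurable_fun_fubini_tonelli_F _ _ _ _ _ mu
  (fun p : E * E => ((f p.1 - f p.2) ^+ 2 * q p.1 p.2)%:E)) => [|p].
  apply/measurable_EFinP; apply: measurable_funM => //; apply: measurable_funX.
  by apply: measurable_funB; apply: measurableT_comp.
by rewrite lee_fin mulr_ge0 ?sqr_ge0.
Qed.

Lemma inA_GamE f x : inA mu q f -> Gam mu q f x = (gam f x)%:E.
Proof.
case=> _ _ [M hM]; rewrite /gam fineK// ge0_fin_numE ?Gam_ge0//.
exact: le_lt_trans (hM x) (ltry _).
Qed.

Lemma bmeas_gam f : inA mu q f -> bmeas (gam f).
Proof.
move=> Af; split.
  apply/measurable_EFinP; rewrite (_ : _ \o _ = Gam mu q f); last first.
    by apply/funext => x /=; rewrite inA_GamE.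
  by apply: measurable_Gam; case: Af.
case: (Af) => _ _ [M hM]; exists M => x; rewrite ger0_norm ?gam_ge0//.
by rewrite -lee_fin -inA_GamE.
Qed.

Lemma inA_bmeas f : inA mu q f -> bmeas f.
Proof. by case. Qed.

Lemma EformE w f : inA mu q f -> Eform mu q w f = wint mu w (gam f).
Proof.
by move=> Af; apply: eq_integral => x _; rewrite inA_GamE// EFinM.
Qed.

Lemma measurable_section x : measurable_fun setT (q x).
Proof. exact: (measurableT_comp mq (pair1_measurable x)). Qed.

End kernel.

Section cutoff_products.
Context (q : E -> E -> R).
Hypothesis mq : measurable_fun setT (fun p : E * E => q p.1 p.2).
Hypothesis q_ge0 : forall x y, 0 <= q x y.
Hypothesis lam_fin : (lam_e mu dist q < +oo)%E.

Definition lam : R := fine (lam_e mu dist q).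

Local Notation mind x y := (Num.min 1 (dist x y ^+ 2)).

Let mind_ge0 x y : 0 <= mind x y.
Proof. by rewrite le_min ler01 sqr_ge0. Qed.

Let measurable_mind x : measurable_fun setT (fun y => mind x y).
Proof.
by apply: measurable_minr => //; apply: measurable_funX; exact: measurable_dist.
Qed.

Let int_mind_ge0 x : (0 <= \int[mu]_y (mind x y * q x y)%:E)%E.
Proof. by apply: integral_ge0 => y _; rewrite lee_fin mulr_ge0. Qed.

Lemma lam_ge0 : 0 <= lam.
Proof.
apply: fine_ge0; apply: (le_trans (int_mind_ge0 point)).
by apply: ereal_sup_ubound; exists point.
Qed.

Lemma int_mind_le x : (\int[mu]_y (mind x y * q x y)%:E <= lam%:E)%E.
Proof.
have h : (\int[mu]_y (mind x y * q x y)%:E <= lam_e mu dist q)%E.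
  by apply: ereal_sup_ubound; exists x.
rewrite /lam fineK// ge0_fin_numE//; exact: le_trans h.
Qed.

Definition cutoff (h : E -> R) : Prop :=
  [/\ measurable_fun setT h, forall x, 0 <= h x <= 1 &
      forall x y, `|h x - h y| <= dist x y].

(** The range and the Lipschitz bound of a cutoff together match the weight integrated in
    [lam_e]. *)
Lemma cutoff_sqr_diff h x y : cutoff h -> (h x - h y) ^+ 2 <= mind x y.
Proof.
case=> _ h01 hl; rewrite le_min -!(real_normK (num_real (h x - h y))).
rewrite ler_sqr ?nnegrE ?dist_ge0// hl andbT expr_le1// ler_norml.
by have := h01 x; have := h01 y; lra.
Qed.

Lemma cutoff_sqr_le1 h x : cutoff h -> h x ^+ 2 <= 1.
Proof. by case=> _ /(_ x) /andP[h0 h1] _; rewrite expr_le1. Qed.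

Lemma cutoff_bmeas h : cutoff h -> bmeas h.
Proof.
by case=> mh h01 _; split=> //; exists 1 => x; have /andP[h0 h1] := h01 x; rewrite ger0_norm.
Qed.

(** Split [f x * h x - f y * h y] as [(f x - f y) * h y + f x * (h x - h y)] and use that the square
    of a sum is at most twice the sum of the squares. The first part gives the energy of [f], the
    second is integrated against [q] by means of [lam]. *)
Lemma sum_Gam_mul_le (I : Type) (s : seq I) (h : I -> E -> R) (f : E -> R) (L L' : R) x :
  measurable_fun setT f -> (forall i, measurable_fun setT (h i)) -> 0 <= L -> 0 <= L' ->
  (forall y, \sum_(i <- s) h i y ^+ 2 <= L) ->
  (forall y, \sum_(i <- s) (h i x - h i y) ^+ 2 <= L' * mind x y) ->
  (\sum_(i <- s) Gam mu q (fun y => f y * h i y)%R x <=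
     (2 * L)%:E * Gam mu q f x + (2 * L' * lam * f x ^+ 2)%:E)%E.
Proof.
move=> mf mh L0 L'0 hL hL'; have mqx := measurable_section mq x.
apply: (@le_trans _ _ ((2 * L)%:E * Gam mu q f x +
    (2 * L' * f x ^+ 2)%:E * \int[mu]_y (mind x y * q x y)%:E)%E); last first.
  apply: leeD2l; rewrite [in leRHS]mulrAC [leRHS]EFinM.
  by apply: lee_wpmul2l; [rewrite lee_fin mulr_ge0 ?sqr_ge0 ?mulr_ge0 | exact: int_mind_le].
apply: sum_integral_le => //.
- by move=> i y; rewrite mulr_ge0 ?sqr_ge0.
- by move=> y; rewrite mulr_ge0 ?sqr_ge0.
- by move=> y; rewrite mulr_ge0 ?sqr_ge0.
- move=> i; apply: measurable_funM => //; apply: measurable_funX.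
  by apply: measurable_funB => //; exact: measurable_funM.
- apply: measurable_funM => //; apply: measurable_funX.
  by apply: measurable_funB => //; exact: measurable_cst.
- by apply: measurable_funM => //; exact: measurable_mind.
- by rewrite mulr_ge0.
- by rewrite mulr_ge0 ?sqr_ge0 ?mulr_ge0.
move=> y; rewrite -mulr_suml mulrA [X in _ + X]mulrA -mulrDl ler_wpM2r//.
rewrite (@le_trans _ _ (\sum_(i <- s) (2 * (f x - f y) ^+ 2 * h i y ^+ 2 +
    2 * f x ^+ 2 * (h i x - h i y) ^+ 2)))//.
  apply: ler_sum => i _; rewrite -subr_ge0.
  (* The slack in the inequality [(a + b)^2 <= 2 a^2 + 2 b^2] is [(a - b)^2]. *)
  rewrite (_ : _ - _ = ((f x - f y) * h i y - f x * (h i x - h i y)) ^+ 2) ?sqr_ge0//.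
  by ring.
rewrite big_split/= -!mulr_sumr lerD//.
  by rewrite [leRHS]mulrAC ler_wpM2l// mulr_ge0 ?sqr_ge0.
rewrite -mulrA [X in _ <= X](_ : _ = 2 * f x ^+ 2 * (L' * mind x y)); last by ring.
by rewrite mulrA ler_wpM2l// mulr_ge0 ?sqr_ge0.
Qed.

(** The same splitting, but [h y ^+ 2] is kept inside the kernel: the energy part stays localised
    and can later be summed over shells without a second [lam] term. *)
Lemma Gam_mul_le h (f : E -> R) x : measurable_fun setT f -> cutoff h ->
  (Gam mu q (fun y => f y * h y)%R x <=
     2%:E * Gam mu (fun x y => (h y ^+ 2 * q x y)%R) f x + (2 * lam * f x ^+ 2)%:E)%E.
Proof.
move=> mf ch; have [mh _ _] := ch; have mqx := measurable_section mq x.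
apply: (@le_trans _ _ (2%:E * Gam mu (fun x y => (h y ^+ 2 * q x y)%R) f x +
    (2 * f x ^+ 2)%:E * \int[mu]_y (mind x y * q x y)%:E)%E); last first.
  apply: leeD2l; rewrite [in leRHS]mulrAC [leRHS]EFinM.
  by apply: lee_wpmul2l; [rewrite lee_fin mulr_ge0 ?sqr_ge0 ?mulr_ge0 | exact: int_mind_le].
have := @sum_integral_le unit [:: tt] (fun=> fun y => (f x * h x - f y * h y) ^+ 2 * q x y)
  (fun y => (f x - f y) ^+ 2 * (h y ^+ 2 * q x y)) (fun y => mind x y * q x y)
  2 (2 * f x ^+ 2).
rewrite big_seq1; apply.
- by move=> _ y; rewrite mulr_ge0 ?sqr_ge0.
- by move=> y; rewrite mulr_ge0 ?sqr_ge0// mulr_ge0 ?sqr_ge0.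
- by move=> y; rewrite mulr_ge0 ?sqr_ge0.
- move=> _; apply: measurable_funM => //; apply: measurable_funX.
  by apply: measurable_funB => //; exact: measurable_funM.
- apply: measurable_funM => //; first apply: measurable_funX.
    by apply: measurable_funB => //; exact: measurable_cst.
  by apply: measurable_funM => //; exact: measurable_funX.
- by apply: measurable_funM => //; exact: measurable_mind.
- by [].
- by rewrite mulr_ge0 ?sqr_ge0.
move=> y; rewrite big_seq1.
rewrite [X in _ <= X + _](_ : _ = 2 * (f x - f y) ^+ 2 * h y ^+ 2 * q x y); last by ring.
rewrite [X in _ <= _ + X]mulrA -mulrDl ler_wpM2r//.
apply: (@le_trans _ _ (2 * (f x - f y) ^+ 2 * h y ^+ 2 +
    2 * f x ^+ 2 * (h x - h y) ^+ 2)).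
  rewrite -subr_ge0.
  rewrite (_ : _ - _ = ((f x - f y) * h y - f x * (h x - h y)) ^+ 2) ?sqr_ge0//.
  by ring.
by rewrite lerD2l ler_wpM2l ?cutoff_sqr_diff// mulr_ge0 ?sqr_ge0.
Qed.

Lemma sum_Gam_weight_le (I : Type) (s : seq I) (h : I -> E -> R) (f : E -> R) (L : R) x :
  measurable_fun setT f -> (forall i, measurable_fun setT (h i)) -> 0 <= L ->
  (forall y, \sum_(i <- s) h i y ^+ 2 <= L) ->
  (\sum_(i <- s) Gam mu (fun x y => (h i y ^+ 2 * q x y)%R) f x <=
     L%:E * Gam mu q f x)%E.
Proof.
move=> mf mh L0 hL; have mqx := measurable_section mq x.
have := @sum_integral_le I s (fun i y => (f x - f y) ^+ 2 * (h i y ^+ 2 * q x y))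
  (fun y => (f x - f y) ^+ 2 * q x y) (fun=> 0) L 0.
rewrite mul0e adde0; apply=> //.
- by move=> i y; rewrite mulr_ge0 ?sqr_ge0// mulr_ge0 ?sqr_ge0.
- by move=> y; rewrite mulr_ge0 ?sqr_ge0.
- move=> i; apply: measurable_funM => //; first apply: measurable_funX.
    by apply: measurable_funB => //; exact: measurable_cst.
  by apply: measurable_funM => //; exact: measurable_funX.
- apply: measurable_funM => //; apply: measurable_funX.
  by apply: measurable_funB => //; exact: measurable_cst.
move=> y; rewrite mulr0 addr0 -mulr_sumr -mulr_suml [leRHS]mulrCA ler_wpM2l ?sqr_ge0//.
by rewrite ler_wpM2r.
Qed.

End cutoff_products.
End jump_form.

(** * Truncation by radial cutoffs *)

Section truncation.
Context {R : realType} {dE : measure_display} {E : measurableType dE}.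
Context (dist : E -> E -> R) (mu : probability E R) (q : E -> E -> R) (o : E).
Hypothesis Edist : polish dist.
Hypothesis mq : measurable_fun setT (fun p : E * E => q p.1 p.2).
Hypothesis q_ge0 : forall x y, 0 <= q x y.
Hypothesis lam_fin : (lam_e mu dist q < +oo)%E.
Implicit Types (f h : E -> R) (x : E).

Local Notation rho := (dist o).
Local Notation lam := (lam dist mu q).
Local Notation gq := (gam mu q).

Definition wker h x y : R := h y ^+ 2 * q x y.

Let lam0 : 0 <= lam.
Proof. exact: lam_ge0. Qed.

Lemma cutoff_radial a b : cutoff dist (fun x => tent a b (rho x)).
Proof.
split=> [|x|x y].
- by apply: measurableT_comp; [exact: measurable_tent | exact: (measurable_dist Edist)].
- by rewrite tent_ge0 tent_le1.
- by rewrite (le_trans (tent_lip _ _ _ _))// (dist_diff Edist).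
Qed.

Definition shell_at (m : nat) x : R := shell m (rho x).

Local Notation shl := shell_at.

Lemma cutoff_shl m : cutoff dist (shl m).
Proof. exact: cutoff_radial. Qed.

Lemma measurable_wker h : measurable_fun setT h ->
  measurable_fun setT (fun p : E * E => wker h p.1 p.2).
Proof.
move=> mh; apply: measurable_funM => //; apply: measurable_funX.
exact: (measurableT_comp mh).
Qed.

Lemma wker_ge0 h x y : 0 <= wker h x y.
Proof. by rewrite mulr_ge0 ?sqr_ge0. Qed.

(** This lets the inequality for [mu] be applied to localised functions. The bound on the carré du
    champ is the product estimate for a single cutoff. *)
Lemma inA_mul f h : inA mu q f -> cutoff dist h -> inA mu q (fun x => f x * h x).
Proof.
move=> Af ch; have [mh h01 _] := ch; have [mf bf bG] := Af.
have [_ [M hM]] : bmeas (fun x => f x * h x).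
  by apply: bmeasM; [exact: inA_bmeas Af | exact: cutoff_bmeas ch].
split; [exact: measurable_funM | by exists M |].
have [_ [N hN]] := bmeas_gam mq q_ge0 Af.
have [_ [P hP]] := inA_bmeas Af.
exists (2 * N + 2 * lam * P ^+ 2) => x.
have := @sum_Gam_mul_le _ _ _ _ _ Edist _ mq q_ge0 lam_fin unit [:: tt] (fun=> h) f 1 1 x mf.
rewrite big_seq1 => /(_ (fun=> mh) ler01 ler01) H.
apply: (le_trans (H _ _)).
- by move=> y; rewrite big_seq1 (cutoff_sqr_le1 _ ch).
- by move=> y; rewrite big_seq1 mul1r (cutoff_sqr_diff Edist _ _ ch).
rewrite !mulr1 (inA_GamE q_ge0 x Af) -EFinM -EFinD lee_fin lerD//.
  by rewrite ler_wpM2l// (le_trans (ler_norm _)).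
rewrite ler_wpM2l ?mulr_ge0 ?lam0//.
by rewrite -(real_normK (num_real (f x))) lerXn2r ?nnegrE// (le_trans (normr_ge0 _) (hP x)).
Qed.

Lemma gam_mul_le1 f h x : inA mu q f -> cutoff dist h ->
  gq (fun x => f x * h x) x <= 2 * gq f x + 2 * lam * f x ^+ 2.
Proof.
move=> Af ch; have [mh h01 _] := ch; have [mf bf bG] := Af.
have := @sum_Gam_mul_le _ _ _ _ _ Edist _ mq q_ge0 lam_fin unit [:: tt] (fun=> h) f 1 1 x mf.
rewrite big_seq1 => /(_ (fun=> mh) ler01 ler01) H.
rewrite -lee_fin EFinD EFinM -!inA_GamE//; last exact: inA_mul.
rewrite !mulr1 in H; apply: H => y; rewrite big_seq1.
  by rewrite (cutoff_sqr_le1 _ ch).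
by rewrite mul1r (cutoff_sqr_diff Edist _ _ ch).
Qed.

Lemma inA_wker f h : inA mu q f -> cutoff dist h -> inA mu (wker h) f.
Proof.
move=> Af ch; have [mh _ _] := ch; have [mf bf [M hM]] := Af; split=> //.
exists M => x; apply: le_trans (hM x).
have := @sum_Gam_weight_le _ _ _ mu _ mq q_ge0 unit [:: tt] (fun=> h) f 1 x mf.
rewrite big_seq1 mul1e => H; apply: H => // y.
by rewrite big_seq1 (cutoff_sqr_le1 _ ch).
Qed.

Lemma gam_mul_le f h x : inA mu q f -> cutoff dist h ->
  gq (fun x => f x * h x) x <= 2 * gam mu (wker h) f x + 2 * lam * f x ^+ 2.
Proof.
move=> Af ch; rewrite -lee_fin EFinD EFinM -!inA_GamE//.
- by have [mf _ _] := Af; exact: (Gam_mul_le Edist mq q_ge0 lam_fin x mf ch).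
- exact: wker_ge0.
- exact: inA_wker.
- exact: inA_mul.
Qed.

Lemma sum_gam_shl f x n N : inA mu q f ->
  \sum_(n <= m < N) gq (fun x => f x * shl m x) x <= 6 * gq f x + 12 * lam * f x ^+ 2.
Proof.
move=> Af; have [mf _ _] := Af.
rewrite -lee_fin -sumEFin EFinD EFinM -inA_GamE//.
under eq_bigr => m _.
  rewrite -inA_GamE; [|exact: q_ge0|exact: (inA_mul Af (cutoff_shl m))].
  over.
have H := @sum_Gam_mul_le _ _ _ _ _ Edist _ mq q_ge0 lam_fin nat (index_iota n N) shl f 3 6 x mf.
(* The overlap constants are 3 for squared shells and 6 for squared differences; the product
   estimate doubles both. *)
rewrite (_ : 6%R = 2 * 3); last by rewrite -natrM.
rewrite (_ : 12%R = 2 * 6); last by rewrite -natrM.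
apply: H => //.
- by move=> i; have [] := cutoff_shl i.
- by move=> y; apply: shell_sqr_overlap; exact: dist_ge0.
- move=> y; apply: shell_diff_overlap; [exact: dist_ge0..|].
  by move=> m; exact: (cutoff_sqr_diff Edist x y (cutoff_shl m)).
Qed.

Lemma sum_gam_wker_shl f x n N : inA mu q f ->
  \sum_(n <= m < N) gam mu (wker (shl m)) f x <= 3 * gq f x.
Proof.
move=> Af; have [mf _ _] := Af.
rewrite -lee_fin -sumEFin EFinM -inA_GamE//.
under eq_bigr => m _.
  rewrite -inA_GamE; [|exact: wker_ge0|exact: (inA_wker Af (cutoff_shl m))].
  over.
apply: (@sum_Gam_weight_le _ _ _ mu _ mq q_ge0 nat (index_iota n N) shl f 3 x mf) => //.
- by move=> i; have [] := cutoff_shl i.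
- by move=> y; apply: shell_sqr_overlap; exact: dist_ge0.
Qed.

(** * Locality from the finite range of the jumps *)

Section range.
Context (k0 : nat).
Hypothesis range : forall x y, k0%:R < dist x y -> q x y = 0.

Lemma gam_eq0 (q' : E -> E -> R) f x :
  (forall y, (f x - f y) ^+ 2 * q' x y = 0) -> gam mu q' f x = 0.
Proof.
by move=> h; rewrite /gam /Gam; under eq_integral do rewrite h; rewrite integral0.
Qed.

(** A jump of length at most [k0] changes [rho] by at most [k0], so from such an [x] both endpoints
    miss the support of the cutoff. *)
Lemma gam_mul_eq0 f a b x :
  (k0%:R < a - rho x) || (k0%:R < rho x - b) ->
  gq (fun x => f x * tent a b (rho x)) x = 0.
Proof.
move=> hx; apply: gam_eq0 => y.
have k00 : 0 <= k0%:R :> R by [].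
have [/range ->|xy] := ltP k0%:R (dist x y); first by rewrite mulr0.
have := dist_diff Edist o x y; rewrite ler_norml => /andP[d1 d2].
by case/orP: hx => hx; rewrite !tent_eq0 ?mulr0 ?subrr ?expr0n ?mul0r//;
  apply/orP; [left|left|right|right]; lra.
Qed.

Lemma gam_wker_eq0 f a b x :
  (k0%:R < a - rho x) || (k0%:R < rho x - b) ->
  gam mu (wker (fun x => tent a b (rho x))) f x = 0.
Proof.
move=> hx; apply: gam_eq0 => y; rewrite /wker.
have [/range ->|xy] := ltP k0%:R (dist x y); first by rewrite !mulr0.
have := dist_diff Edist o x y; rewrite ler_norml => /andP[d1 d2].
by case/orP: hx => hx; rewrite !tent_eq0 ?expr0n ?mul0r ?mulr0//;
  apply/orP; [left|right]; lra.
Qed.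

(** Where the left side is nonzero, [rho x] lies within [k0] of the support of shell [m], so a shell
    with index at distance at most [k0 + 1] from [m] equals 1 at [x], and [f x ^+ 2] is one of the
    summands. Truncated subtraction may repeat the index 0, which adds only nonnegative terms. *)
Lemma gam_shl_le f x m : inA mu q f ->
  gq (fun x => f x * shl m x) x <= 2 * gam mu (wker (shl m)) f x +
    2 * lam * \sum_(i < (2 * k0).+3) (f x * shl (m + i - k0.+1)%N x) ^+ 2.
Proof.
move=> Af; set S := \sum_(i < _) _.
have S0 : 0 <= S by apply: sumr_ge0 => i _; exact: sqr_ge0.
have rhs0 : 0 <= 2 * gam mu (wker (shl m)) f x + 2 * lam * S.
  rewrite addr_ge0 ?mulr_ge0 ?lam0 ?gam_ge0//.
  exact: wker_ge0.
have [h1|h1] := ltP k0%:R (m%:R - 1 - rho x).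
  by rewrite /shell_at /shell gam_mul_eq0// h1.
have [h2|h2] := ltP k0%:R (rho x - (m%:R + 2)).
  by rewrite /shell_at /shell gam_mul_eq0// h2 orbT.
apply: (le_trans (gam_mul_le x Af (cutoff_shl m))).
rewrite lerD2l ler_wpM2l ?mulr_ge0 ?lam0//.
have r0 : 0 <= rho x := dist_ge0 Edist o x.
have /andP[t1 t2] := truncn_itv r0; set p := Num.truncn (rho x) in t1 t2.
(* the unit interval containing [rho x]; its right end is taken when [rho x = m + 2 + k0] *)
pose j := minn p (m + k0.+1).
have jle : (j%:R : R) <= rho x.
  by rewrite (le_trans _ t1)// ler_nat geq_minl.
have jge : rho x <= j%:R + 1.
  rewrite /j; have [_|_] := leqP p (m + k0.+1); first by move: t2; rewrite -natr1; exact: ltW.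
  by rewrite natrD -natr1; lra.
have jm : (m <= j + k0.+1)%N.
  rewrite /j; case: (leqP p (m + k0.+1)) => _; last by lia.
  rewrite -ltnS -(ltr_nat R) -natr1 natrD -natr1.
  by move: t2; rewrite -natr1; lra.
have ji : ((j + k0.+1) - m < (2 * k0).+3)%N.
  have : (j <= m + k0.+1)%N by exact: geq_minr.
  by rewrite ltn_subLR//; lia.
(* The summand [i = j + k0 + 1 - m] is that of shell [j]; the others are dropped. *)
rewrite /S (bigD1 (Ordinal ji) isT)/= ler_wpDr//.
  by apply: sumr_ge0 => i _; exact: sqr_ge0.
by rewrite subnKC// addnK /shell_at /shell tent_eq1 ?mulr1//; lra.
Qed.

End range.
End truncation.

(** * Comparison of the two weights *)

Section two_weights.
Context {R : realType} {d : measure_display} {T : measurableType d}.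
Context (mu : probability T R).

Lemma le_wmean_weights (w w' f g : T -> R) :
  measurable_fun setT w -> (forall x, 0 <= w x) -> (\int[mu]_x (w x)%:E = 1)%E ->
  measurable_fun setT w' -> (forall x, 0 <= w' x) -> (\int[mu]_x (w' x)%:E = 1)%E ->
  bmeas f -> bmeas g -> (forall x, w x * f x <= w' x * g x) ->
  wmean mu w f <= wmean mu w' g.
Proof.
move=> mw w0 w1 mw' w'0 w'1 bf bg fg; rewrite -lee_fin -!wintE//.
apply: le_integral => //; try exact: integrable_weighted.
by move=> x _; rewrite lee_fin.
Qed.

Lemma int1 : (\int[mu]_x (1%R : R)%:E = 1)%E.
Proof. by rewrite integral_cst// mul1e; exact: probability_setT. Qed.

Local Notation mean1 := (wmean mu (fun=> 1)).

Lemma mean1_indic (S : set T) : measurable S -> mean1 \1_S = fine (mu S).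
Proof.
move=> mS; rewrite /wmean /wint; under eq_integral do rewrite mul1r.
by rewrite integral_indic// setIT.
Qed.

Lemma bmeas_indic (S : set T) : measurable S -> bmeas (\1_S : T -> R).
Proof.
move=> mS; split; first exact: measurable_indic.
by exists 1 => x; rewrite indicE; case: (x \in S); rewrite ?normr1 ?normr0.
Qed.

(** Cauchy-Schwarz for [g] times the indicator of [S], obtained by integrating
    [2 t |g| <= g^2 + t^2] on [S] and optimising over [t]. *)
Lemma sqr_mean1_le (S : set T) (g : T -> R) : measurable S -> bmeas g ->
  (forall x, ~ S x -> g x = 0) ->
  mean1 (fun x => `|g x|) ^+ 2 <= fine (mu S) * mean1 (fun x => g x ^+ 2).
Proof.
move=> mS bg gS; set M := mean1 (fun x => `|g x|); set N := mean1 (fun x => _ ^+ 2).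
have mw := @measurable_cst _ _ T R setT 1.
have w0 (x : T) : 0 <= 1 :> R by [].
have key t : 2 * t * M <= N + t ^+ 2 * fine (mu S).
  have bi := bmeas_indic mS.
  rewrite /M /N -mean1_indic// -!(wmeanZ mw w0 int1)//; [|exact: bmeas_norm].
  rewrite -(wmeanD mw w0 int1); [|exact: bmeasX|exact: bmeasZ].
  apply: (le_wmean mw w0 int1).
  - by apply: bmeasZ; exact: bmeas_norm.
  - by apply: bmeasD; [exact: bmeasX | exact: bmeasZ].
  move=> x; rewrite indicE; have [xS|xS] := boolP (x \in S).
    rewrite mulr1 -(real_normK (num_real (g x))).
    by have := sqr_ge0 (`|g x| - t); rewrite sqrrB -mulr_natl; clear w0; lra.
  by rewrite gS ?normr0 ?expr0n ?mulr0 ?addr0// => /mem_set; exact/negP.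
clear w0; have a0 : 0 <= fine (mu S) by rewrite fine_ge0.
have M0 : 0 <= M by exact: wmean_ge0.
have N0 : 0 <= N by apply: wmean_ge0 => // x; exact: sqr_ge0.
(* When [S] is null the quadratic in [t] degenerates to [2 t M <= N] for all [t], which excludes
   [M > 0]. Otherwise the optimal [t] is [M / mu S]. *)
have [a1|a1] := eqVneq (fine (mu S)) 0.
  rewrite a1 mul0r; have {M0} := M0; rewrite le_eqVlt => /orP[/eqP <-|M0].
    by rewrite expr0n.
  have := key ((N + 1) / M); rewrite a1 mulr0 addr0 -mulrA divfK ?gt_eqF//.
  by lra.
have a2 : 0 < fine (mu S) by rewrite lt_def a1.
have := key (M / fine (mu S)); set u := M / _.
have -> : M = u * fine (mu S) by rewrite divfK.
move=> h; rewrite exprMn [leLHS](_ : _ = fine (mu S) * (u ^+ 2 * fine (mu S))); last by ring.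
by rewrite ler_wpM2l//; move: h; rewrite [2 * u * _](_ : _ = 2 * (u ^+ 2 * fine (mu S))); [lra | ring].
Qed.

End two_weights.

(** * Estimates for the perturbed measure on the algebra [A] *)

Section perturbation.
Context {R : realType} {dE : measure_display} {E : measurableType dE}.
Context (dist : E -> E -> R) (mu : probability E R) (q : E -> E -> R) (o : E).
Hypothesis Edist : polish dist.
Hypothesis mq : measurable_fun setT (fun p : E * E => q p.1 p.2).
Hypothesis q_ge0 : forall x y, 0 <= q x y.
Hypothesis lam_fin : (lam_e mu dist q < +oo)%E.
Context (V : E -> R) (beta : R -> R) (k0 : nat).
Hypothesis mV : measurable_fun setT V.
Hypothesis V_bounded : forall r : R, exists M : R, forall x, dist o x <= r -> `|V x| <= M.
Hypothesis V_int : (\int[mu]_x (expR (V x))%:E = 1)%E.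
Hypothesis beta_gt0 : forall r, 0 < r -> 0 < beta r.
Hypothesis spi : forall r : R, 0 < r -> forall (f : E -> R) (e : R),
     closure_val mu q (fun=> 1%R) f e ->
     (wint mu (fun=> 1%R) (fun x => f x ^+ 2)%R
        <= (r * e)%:E + (beta r)%:E * (wint mu (fun=> 1%R) (fun x => `|f x|)%R) ^+ 2)%E.
Hypothesis range : forall x y, k0%:R < dist x y -> q x y = 0.
Implicit Types (f h : E -> R) (x : E).

Local Notation rho := (dist o).
Local Notation lam := (lam dist mu q).
Local Notation gq := (gam mu q).
Local Notation mean1 := (wmean mu (fun=> 1)).
Local Notation meanV := (wmean mu (wV V)).
Local Notation shl := (shell_at dist o).
Local Notation tail_arg := (tail_arg mu dist o).
Local Notation Knk := (Knk dist o V).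

Let lam0 : 0 <= lam.
Proof. exact: lam_ge0. Qed.

Let m1 : measurable_fun setT (fun=> 1 : R) := @measurable_cst _ _ E R setT 1.

Let one_ge0 : forall x, 0 <= (fun=> 1 : R) x.
Proof. by []. Qed.

Let i1 : (\int[mu]_x ((fun=> 1 : R) x)%:E = 1)%E := int1 mu.

Let mwV : measurable_fun setT (wV V).
Proof. exact: (measurableT_comp (@measurable_expR R)). Qed.

Let wV_ge0 x : 0 <= wV V x.
Proof. exact: expR_ge0. Qed.

(** The constant sequence [f] shows that [f] lies in the domain of the closure, with its own energy
    as value. *)
Lemma spi_inA f r : 0 < r -> inA mu q f ->
  mean1 (fun x => f x ^+ 2) <= r * mean1 (gq f) + beta r * mean1 (fun x => `|f x|) ^+ 2.
Proof.
move=> r0 Af; have bf := inA_bmeas Af.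
have := spi r0 (f := f) (e := mean1 (gq f)).
rewrite !(wintE m1 one_ge0 i1); [|exact: bmeas_norm|exact: bmeasX].
rewrite -EFin_expe -EFinM -EFinD lee_fin; apply; split.
  by split; [case: bf | rewrite (wintE m1 one_ge0 i1) ?ltry//; exact: bmeasX].
exists (fun=> f); split=> //.
- rewrite (_ : (fun n : nat => _) = cst 0%E); first exact: cvg_cst.
  apply/funext => n; rewrite /wint; under eq_integral do rewrite subrr expr0n mulr0.
  exact: integral0.
- move=> e e0; exists 0%N => n m _ _; rewrite /Eform.
  rewrite integral0_eq ?lee_fin ?ltW// => x _; rewrite /Gam integral0_eq ?mule0// => y _.
  by rewrite /= !subrr expr0n mul0r.
- rewrite EformE// (wintE m1 one_ge0 i1); [exact: cvg_cst | exact: bmeas_gam].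
Qed.

(** With [a] the mass of the support region, Cauchy-Schwarz bounds the squared mean of [|f|] by [a]
    times the mean of [f^2]. As [beta r <= 1 / (2 a)], the defect is at most half the left side and
    is absorbed, whence the factor 2. *)
Lemma local_poincare f (m : nat) r : inA mu q f ->
  (forall x, ~ m%:R - 1 < rho x -> f x = 0) -> 0 < r ->
  ((beta r)%:E <= tail_arg m)%E ->
  mean1 (fun x => f x ^+ 2) <= 2 * r * mean1 (gq f).
Proof.
move=> Af fm r0 br; have := spi_inA r0 Af.
have mS : measurable [set x | m%:R - 1 < rho x].
  rewrite -[X in measurable X]setTI (_ : [set x | _] = rho @^-1` `]m%:R - 1, +oo[).
    exact: (measurable_dist Edist o).
  by apply/seteqP; split => x /=; rewrite in_itv/= andbT.
have := sqr_mean1_le mu mS (inA_bmeas Af) fm.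
have b0 := beta_gt0 r0.
have N0 : 0 <= mean1 (fun x => f x ^+ 2).
  by apply: wmean_ge0 => // x; exact: sqr_ge0.
move: br; rewrite /Defs.tail_arg.
set a := fine (mu [set x | m%:R - 1 < dist o x]).
rewrite /rho -/a.
set X := mean1 _ in N0 *; set Y := _ ^+ 2; set Z := mean1 _.
have a0 : 0 <= a by rewrite fine_ge0.
(* For [a = 0] the value of [tail_arg] is infinite and says nothing about [beta r], but then
   Cauchy-Schwarz makes the defect vanish. *)
have [-> _|an0] := eqVneq a 0.
  by rewrite mul0r => h1 h2; have := ler_wpM2l (ltW b0) h1; lra.
have a1 : 0 < a by rewrite lt_def an0.
rewrite lee_fin -(ler_pM2r (_ : 0 < 2 * a)) ?mulr_gt0// mulVf ?gt_eqF ?mulr_gt0//.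
move=> ba h1 h2; have := ler_wpM2l (ltW b0) h1.
have := ler_wpM2r N0 ba.
rewrite (_ : beta r * (2 * a) * X = 2 * (beta r * (a * X))); last by ring.
by rewrite mul1r; lra.
Qed.

Let ball_has_sup a : 0 <= a -> has_sup [set V x | x in [set x | rho x <= a]].
Proof.
move=> a0; split.
  by exists (V o); exists o => //=; case: Edist => -[_ [+ _]] _ _ _ => /(_ o o) [_ ->].
have [M hM] := V_bounded a; exists M => _ [x /= xa <-].
by rewrite (le_trans (ler_norm _))// hM.
Qed.

Lemma le_supV a x : rho x <= a -> V x <= supV dist o V a.
Proof.
move=> xa; apply: ub_le_sup; last by exists x.
by have [] := ball_has_sup (le_trans (dist_ge0 Edist o x) xa).
Qed.

Lemma ge_infV a x : rho x <= a -> infV dist o V a <= V x.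
Proof.
move=> xa; apply: ge_inf; last by exists x.
have [M hM] := V_bounded a; exists (- M) => _ [y /= ya <-].
by have := hM y ya; rewrite ler_norml => /andP[].
Qed.

(** The condition [0 <= a] puts [o] in the smaller ball, so that [sup] is not at its default
    value. *)
Lemma supV_mono a b : 0 <= a -> a <= b -> supV dist o V a <= supV dist o V b.
Proof.
move=> a0 ab; apply: ge_sup; first by have [] := ball_has_sup a0.
by move=> _ [x /= xa <-]; apply: le_supV; exact: le_trans ab.
Qed.

(** Where [G] lives, the density is at least the exponential of [infV] at radius [m + k + 2], and
    [Knk] is the gap between the two exponents. *)
Lemma mean_transfer (m k : nat) G : bmeas G -> (forall x, 0 <= G x) ->
  (forall x, m%:R + k%:R + 2 < rho x -> G x = 0) ->
  expR (supV dist o V (m%:R + 2)) * mean1 G <= expR (Knk m k) * meanV G.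
Proof.
move=> bG G0 GE; rewrite -(wmeanZ m1 one_ge0 i1)// -(wmeanZ mwV wV_ge0 V_int)//.
apply: le_wmean_weights => //; try exact: bmeasZ.
move=> x; have [xr|/GE ->] := leP (rho x) (m%:R + k%:R + 2); last by rewrite !mulr0.
rewrite mul1r mulrA ler_wpM2r// /wV -expRD ler_expR /Defs.Knk.
by have := ge_infV xr; lra.
Qed.

Lemma meanV_le a G : bmeas G -> (forall x, 0 <= G x) ->
  (forall x, a < rho x -> G x = 0) ->
  meanV G <= expR (supV dist o V a) * mean1 G.
Proof.
move=> bG G0 GE; rewrite -(wmeanZ m1 one_ge0 i1)//.
apply: le_wmean_weights => //; first exact: bmeasZ.
move=> x; have [xr|/GE ->] := leP (rho x) a; last by rewrite !mulr0.
by rewrite mul1r ler_wpM2r// /wV ler_expR le_supV.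
Qed.

Lemma mean1_le a G : bmeas G -> (forall x, 0 <= G x) ->
  (forall x, a < rho x -> G x = 0) ->
  expR (infV dist o V a) * mean1 G <= meanV G.
Proof.
move=> bG G0 GE; rewrite -(wmeanZ m1 one_ge0 i1)//.
apply: le_wmean_weights => //; first exact: bmeasZ.
move=> x; have [xr|/GE ->] := leP (rho x) a; last by rewrite !mulr0.
by rewrite mul1r ler_wpM2r// /wV ler_expR ge_infV.
Qed.

(** The super Poincaré inequality for [mu] is applied to [f] times the inner cutoff. Changing the
    measure costs [exp Knk] for the energy, and once the supremum and twice the infimum of [V] for
    the squared mean of [|f|], which is [exp Jnk]. *)
Lemma inner_bound f (n k : nat) s : inA mu q f -> (k0 <= k)%N -> 0 < s ->
  meanV (fun x => (f x * tent (- 2) (n%:R + 1) (rho x)) ^+ 2) <=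
    s * expR (Knk n k) * (2 * meanV (gq f) + 2 * lam * meanV (fun x => f x ^+ 2)) +
    expR (Jnk dist o V n k) * beta s * meanV (fun x => `|f x|) ^+ 2.
Proof.
(* The ascending slope of this trapezoid lies over negative numbers. As [rho] is nonnegative, [l] is
   1 for [rho <= n] and 0 for [rho >= n + 1]. *)
move=> Af kk s0; set l := fun x => tent (- 2) (n%:R + 1) (rho x).
have cl : cutoff dist l by exact: cutoff_radial.
have bf := inA_bmeas Af; have bl := cutoff_bmeas cl.
have Afl := inA_mul Edist mq q_ge0 lam_fin Af cl.
have n0 : 0 <= n%:R :> R by [].
have n1 : n%:R + 1 <= n%:R + 2 :> R by lra.
have nk : n%:R + 1 <= n%:R + k%:R + 2 :> R by have : 0 <= k%:R :> R by []; lra.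
(* The prefactor has radius [n + 1], as in [Jnk]; for the energy term it is enlarged to the radius
   [n + 2] of [Knk]. *)
have sS : expR (supV dist o V (n%:R + 1)) <= expR (supV dist o V (n%:R + 2)).
  by rewrite ler_expR supV_mono// addr_ge0.
have kk' : k0%:R <= k%:R :> R by rewrite ler_nat.
have l0 x : n%:R + 1 < rho x -> l x = 0.
  by move=> h; rewrite /l tent_eq0// (ltW h) orbT.
have h1 : meanV (fun x => (f x * l x) ^+ 2) <=
    expR (supV dist o V (n%:R + 1)) * mean1 (fun x => (f x * l x) ^+ 2).
  apply: meanV_le; [exact/bmeasX/bmeasM | by move=> x; exact: sqr_ge0 |].
  by move=> x /l0 ->; rewrite mulr0 expr0n.
have h2 := spi_inA s0 Afl.
have bg := bmeas_gam mq q_ge0 Afl.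
have h3 : expR (supV dist o V (n%:R + 2)) * mean1 (gq (fun x => f x * l x)) <=
    expR (Knk n k) * meanV (gq (fun x => f x * l x)).
  apply: mean_transfer => //; first by move=> x; exact: gam_ge0.
  move=> x hx; apply: (@gam_mul_eq0 _ _ _ dist mu q o Edist k0 range f (- 2) (n%:R + 1)).
  by apply/orP; right; lra.
have h4 : meanV (gq (fun x => f x * l x)) <=
    2 * meanV (gq f) + 2 * lam * meanV (fun x => f x ^+ 2).
  have bgf := bmeas_gam mq q_ge0 Af.
  rewrite -!(wmeanZ mwV wV_ge0 V_int)//; last exact: bmeasX.
  rewrite -(wmeanD mwV wV_ge0 V_int); [|exact: bmeasZ|exact/bmeasZ/bmeasX].
  apply: (le_wmean mwV wV_ge0 V_int) => //.
    by apply: bmeasD; [exact: bmeasZ | exact/bmeasZ/bmeasX].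
  by move=> x; exact: (gam_mul_le1 Edist mq q_ge0 lam_fin).
have h5 : expR (infV dist o V (n%:R + k%:R + 2)) * mean1 (fun x => `|f x * l x|) <=
    meanV (fun x => `|f x|).
  apply: (@le_trans _ _ (meanV (fun x => `|f x * l x|))).
    apply: mean1_le; [exact/bmeas_norm/bmeasM | by [] |].
    by move=> x hx; rewrite l0 ?mulr0 ?normr0//; exact: le_lt_trans hx.
  apply: (le_wmean mwV wV_ge0 V_int); [exact/bmeas_norm/bmeasM|exact: bmeas_norm|].
  move=> x; rewrite normrM ler_piMr//; case: cl => _ /(_ x) /andP[h _] _.
  by rewrite ger0_norm// tent_le1.
have g0 : 0 <= mean1 (gq (fun x => f x * l x)).
  by apply: wmean_ge0 => // x; exact: gam_ge0.
have a0 : 0 <= mean1 (fun x => `|f x * l x|) by exact: wmean_ge0.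
apply: (le_trans h1); apply: (le_trans (ler_wpM2l (expR_ge0 _) h2)).
rewrite mulrDr lerD//.
  rewrite mulrCA -mulrA ler_wpM2l ?(ltW s0)//.
  apply: (le_trans (ler_wpM2r g0 sS)); apply: (le_trans h3).
  by rewrite ler_wpM2l ?expR_ge0.
rewrite /Jnk mulrCA [leRHS](_ : _ = beta s * (expR (supV dist o V (n%:R + 1) - 2 * infV dist o V (n%:R + k%:R + 2)) * meanV (fun x => `|f x|) ^+ 2)); last by ring.
rewrite ler_wpM2l ?(ltW (beta_gt0 s0))// expRD -mulrA ler_wpM2l ?expR_ge0//.
move: h5; set m := mean1 _; set I := infV _ _ _ _; set G := meanV _ => h5.
have -> : m ^+ 2 = expR (- (2 * I)) * (expR I * m) ^+ 2.
  rewrite exprMn [RHS]mulrA (expr2 (expR I)) -!expRD (_ : _ + _ = 0); last by ring.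
  by rewrite expR0 mul1r.
rewrite ler_wpM2l ?expR_ge0// lerXn2r// nnegrE ?mulr_ge0 ?expR_ge0//.
exact: wmean_ge0.
Qed.

Lemma bmeas_mul_shl f m : inA mu q f -> bmeas (fun x => f x * shl m x).
Proof.
by move=> Af; apply: bmeasM; [exact: inA_bmeas Af | exact: cutoff_bmeas (cutoff_shl o Edist m)].
Qed.

Lemma inA_mul_shl f m : inA mu q f -> inA mu q (fun x => f x * shl m x).
Proof. by move=> Af; exact: (inA_mul Edist mq q_ge0 lam_fin Af (cutoff_shl o Edist m)). Qed.

Lemma bmeas_gam_shl f m : inA mu q f -> bmeas (gq (fun x => f x * shl m x)).
Proof. by move=> Af; apply: (bmeas_gam mq q_ge0); exact: inA_mul_shl. Qed.

(** The energy of shell [j] reaches only up to radius [j + 2 + k0], which is at most [m + k + 2].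
    Allowing [j < m] makes it possible to pair the prefactor of one shell with the energy of
    another. *)
Lemma mean_transfer_shl f (j m k : nat) : inA mu q f -> (j <= m)%N -> (k0 <= k)%N ->
  expR (supV dist o V (m%:R + 2)) * mean1 (gq (fun x => f x * shl j x)) <=
  expR (Knk m k) * meanV (gq (fun x => f x * shl j x)).
Proof.
move=> Af jm kk; apply: mean_transfer; first exact: bmeas_gam_shl.
  by move=> x; exact: gam_ge0.
move=> x hx.
apply: (@gam_mul_eq0 _ _ _ dist mu q o Edist k0 range f (j%:R - 1) (j%:R + 2)).
have kk' : k0%:R <= k%:R :> R by rewrite ler_nat.
have jm' : j%:R <= m%:R :> R by rewrite ler_nat.
by apply/orP; right; lra.
Qed.

Lemma meanV_shl_le f m : inA mu q f ->
  meanV (fun x => (f x * shl m x) ^+ 2) <=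
  expR (supV dist o V (m%:R + 2)) * mean1 (fun x => (f x * shl m x) ^+ 2).
Proof.
move=> Af; apply: meanV_le; first exact/bmeasX/bmeas_mul_shl.
  by move=> x; exact: sqr_ge0.
by move=> x hx; rewrite /shell_at /shell tent_eq0 ?mulr0 ?expr0n// (ltW hx) orbT.
Qed.

Lemma sum_meanV_gam_shl f n N : inA mu q f ->
  \sum_(n <= m < N) meanV (gq (fun x => f x * shl m x)) <=
  6 * meanV (gq f) + 12 * lam * meanV (fun x => f x ^+ 2).
Proof.
move=> Af; have bf := inA_bmeas Af; have bgf := bmeas_gam mq q_ge0 Af.
rewrite -(wmean_sum mwV wV_ge0 V_int); last by move=> m; exact: bmeas_gam_shl.
rewrite -!(wmeanZ mwV wV_ge0 V_int)//; last exact: bmeasX.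
rewrite -(wmeanD mwV wV_ge0 V_int); [|exact: bmeasZ|exact/bmeasZ/bmeasX].
apply: (le_wmean mwV wV_ge0 V_int).
- by apply: bmeas_sum => m; exact: bmeas_gam_shl.
- by apply: bmeasD; [exact: bmeasZ | exact/bmeasZ/bmeasX].
- by move=> x; exact: sum_gam_shl.
Qed.

Definition shell_poincare (m : nat) (c : R) : Prop := forall f, inA mu q f ->
  mean1 (fun x => (f x * shl m x) ^+ 2) <= 2 * c * mean1 (gq (fun x => f x * shl m x)).

(** The infimum defining [betainv] need not be attained, so the local inequality is used for some
    [r] slightly above it. *)
Lemma shell_poincare_betainv m c :
  betainv beta (tail_arg m) = c%:E -> shell_poincare m c.
Proof.
move=> bc f Af; set A := mean1 _; set B := mean1 _.
have B0 : 0 <= B by apply: wmean_ge0 => // x; exact: gam_ge0.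
(* This choice gives [2 * de * B <= e]; the added 1 covers [B = 0]. *)
apply/ler_addgt0Pr => e e0; pose de := e / (2 * B + 1).
have B1 : 0 < 2 * B + 1 by lra.
have de0 : 0 < de by rewrite divr_gt0.
have [_ [r [r0 hr] <-] rc] : exists2 y, [set r%:E | r in [set r : R | 0 < r /\
    ((beta r)%:E <= tail_arg m)%E]] y & (y < (c + de)%:E)%E.
  by apply: ereal_inf_lt; rewrite -/(betainv beta (tail_arg m)) bc lte_fin ltrDl.
have h : A <= 2 * r * B.
  apply: (@local_poincare (fun x => f x * shl m x) m) => //; first exact: inA_mul_shl.
  move=> x /negP; rewrite -leNgt => hx.
  by rewrite /shell_at /shell tent_eq0 ?mulr0// hx.
apply: (le_trans h); rewrite lte_fin in rc.
have : de * (2 * B + 1) = e by rewrite divfK// gt_eqF.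
have := ler_wpM2r B0 (ltW rc); rewrite mulrDr mulrDl.
by lra.
Qed.

Lemma betainv_ge0 s : (0 <= betainv beta s)%E.
Proof. by apply: le_ereal_inf_tmp => _ [r [r0 _] <-]; rewrite lee_fin ltW. Qed.

Lemma epsnk_ge0 n k : (0 <= epsnk mu dist o V beta n k)%E.
Proof.
apply: (@le_trans _ _ (betainv beta (tail_arg n) * (expR (Knk n k))%:E)%E).
  by rewrite mule_ge0 ?betainv_ge0// lee_fin expR_ge0.
by apply: ereal_sup_ubound; exists n => /=.
Qed.

(** Since [exp Knk] is positive, finiteness of the supremum forces every [betainv] in it to be
    finite. The last clause is what later shows that the constants become small far out. *)
Lemma shell_constants n k : (epsnk mu dist o V beta n k < +oo)%E ->
  exists b : nat -> R, forall j, (n <= j)%N ->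
    [/\ 0 <= b j, b j * expR (Knk j k) <= fine (epsnk mu dist o V beta n k),
        shell_poincare j (b j) &
        forall r, 0 < r -> ((beta r)%:E <= tail_arg j)%E -> b j <= r].
Proof.
move=> eoo; exists (fun j => fine (betainv beta (tail_arg j))) => j nj.
have h : (betainv beta (tail_arg j) * (expR (Knk j k))%:E <= epsnk mu dist o V beta n k)%E.
  by apply: ereal_sup_ubound; exists j.
have bfin : betainv beta (tail_arg j) \is a fin_num.
  rewrite ge0_fin_numE ?betainv_ge0// ltey; apply/eqP => boo.
  by move: h; rewrite boo gt0_mulye ?lte_fin ?expR_gt0// leye_eq => /eqP e; rewrite e in eoo.
have efin : epsnk mu dist o V beta n k \is a fin_num by rewrite ge0_fin_numE ?epsnk_ge0.
split.
- by rewrite fine_ge0 ?betainv_ge0.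
- by rewrite -lee_fin EFinM !fineK.
- by apply: shell_poincare_betainv; rewrite fineK.
- move=> r r0 hr; rewrite -lee_fin fineK//.
  by apply: ereal_inf_lbound; exists r.
Qed.

(** With [M] a bound for [f], [f^2] is dominated pointwise by its inner part, the shells from [n] to
    [N - 1], and [M ^+ 2] on [rho >= N]. The last mean tends to 0 as [N] grows, and [C] bounds the
    shells uniformly in [N]. *)
Lemma meanV_sqr_le f n C : inA mu q f ->
  (forall N, \sum_(n <= m < N) meanV (fun x => (f x * shl m x) ^+ 2) <= C) ->
  meanV (fun x => f x ^+ 2) <=
    meanV (fun x => (f x * tent (- 2) (n%:R + 1) (rho x)) ^+ 2) + C.
Proof.
move=> Af hC; have bf := inA_bmeas Af; have [_ [M hM]] := bf.
have M0 : 0 <= M by exact: le_trans (normr_ge0 _) (hM o).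
have cl : cutoff dist (fun x => tent (- 2) (n%:R + 1) (rho x)) by exact: cutoff_radial.
have bl := cutoff_bmeas cl.
apply/ler_addgt0Pr => e e0.
have [N /(_ N (leqnn N)) hN] := @wmean_tail _ _ _ mu _ mwV wV_ge0 V_int rho (e / (M ^+ 2 + 1))
  (measurable_dist Edist o) (divr_gt0 e0 (ltr_wpDl (sqr_ge0 M) ltr01)).
have bB : bmeas (fun x => (N%:R <= rho x)%R%:R : R) := bmeas_ge _ (measurable_dist Edist o).
have bs : bmeas (fun x => \sum_(n <= m < N) (f x * shl m x) ^+ 2).
  by apply: bmeas_sum => m; exact/bmeasX/bmeas_mul_shl.
have bfl : bmeas (fun x => (f x * tent (- 2) (n%:R + 1) (rho x)) ^+ 2).
  exact/bmeasX/bmeasM.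
apply: (@le_trans _ _ (meanV (fun x => (f x * tent (- 2) (n%:R + 1) (rho x)) ^+ 2 +
    (\sum_(n <= m < N) (f x * shl m x) ^+ 2 + M ^+ 2 * (N%:R <= rho x)%R%:R)))); last first.
  rewrite !(wmeanD mwV wV_ge0 V_int)//; [|exact: bmeasZ|by apply: bmeasD => //; exact: bmeasZ].
  rewrite (wmean_sum mwV wV_ge0 V_int); last by move=> m; exact/bmeasX/bmeas_mul_shl.
  rewrite (wmeanZ mwV wV_ge0 V_int)// -addrA lerD2l lerD//.
  apply: (le_trans (ler_wpM2l (sqr_ge0 M) hN)).
  have M1 : 0 < M ^+ 2 + 1 by rewrite ltr_wpDl ?sqr_ge0.
  by rewrite mulrCA ler_piMr ?(ltW e0)// ler_pdivrMr// mul1r lerDl.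
apply: (le_wmean mwV wV_ge0 V_int); first exact: bmeasX.
  by apply: bmeasD => //; apply: bmeasD => //; exact: bmeasZ.
move=> x; have r0 := dist_ge0 Edist o x.
have s0 : 0 <= \sum_(n <= m < N) (f x * shl m x) ^+ 2.
  by apply: sumr_ge0 => m _; exact: sqr_ge0.
have t0 : 0 <= M ^+ 2 * (N%:R <= rho x)%R%:R by rewrite mulr_ge0 ?sqr_ge0.
have u0 : 0 <= (f x * tent (- 2) (n%:R + 1) (rho x)) ^+ 2 by exact: sqr_ge0.
have [xn|/ltW xn] := leP (rho x) n%:R.
  by rewrite tent_eq1 ?mulr1; [rewrite lerDl addr_ge0|lra|lra].
have fM : f x ^+ 2 <= M ^+ 2 by rewrite -(real_normK (num_real (f x))) lerXn2r ?nnegrE.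
have [xN|] := boolP (N%:R <= rho x).
  by rewrite mulr1n mulr1 (le_trans fM)// addrA lerDr addr_ge0.
rewrite -ltNge => xN.
have /andP[t1 t2] := truncn_itv r0.
have t3 : rho x < (Num.truncn (rho x))%:R + 1 by rewrite natr1.
(* For [n < rho x < N] the shell indexed by the integer part of [rho x] equals 1 at [x]. *)
have pin : Num.truncn (rho x) \in index_iota n N.
  rewrite mem_index_iota; apply/andP; split.
    by rewrite -ltnS -(ltr_nat R) (le_lt_trans xn).
  by rewrite -(ltr_nat R) (le_lt_trans t1).
have shl1 : shl (Num.truncn (rho x)) x = 1.
  by rewrite /shell_at /shell tent_eq1//; lra.
rewrite (bigD1_seq _ pin) ?iota_uniq//= shl1 mulr1.
have : 0 <= \sum_(n <= i < N | i != Num.truncn (rho x)) (f x * shl i x) ^+ 2.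
  by apply: sumr_ge0 => m _; exact: sqr_ge0.
by move=> v0; rewrite mulr0n mulr0 addr0 addrCA lerDl addr_ge0.
Qed.

(** On each shell: pass to [mu], use the Poincaré inequality there, and return to [mu_V] at cost
    [exp Knk], which [b] turns into [eps]. The overlap bound sums the energies. *)
Lemma outer_bound f (b : nat -> R) (n k N : nat) (eps : R) : inA mu q f -> (k0 <= k)%N ->
  (forall j, (n <= j)%N ->
    [/\ 0 <= b j, b j * expR (Knk j k) <= eps & shell_poincare j (b j)]) ->
  \sum_(n <= m < N) meanV (fun x => (f x * shl m x) ^+ 2) <=
  2 * eps * (6 * meanV (gq f) + 12 * lam * meanV (fun x => f x ^+ 2)).
Proof.
move=> Af kk hb.
have e0 : 0 <= eps.
  by have [b0 be _] := hb n (leqnn n); rewrite (le_trans _ be)// mulr_ge0 ?expR_ge0.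
apply: (@le_trans _ _ (\sum_(n <= m < N) 2 * eps * meanV (gq (fun x => f x * shl m x)))); last first.
  by rewrite -mulr_sumr ler_wpM2l ?mulr_ge0// sum_meanV_gam_shl.
rewrite big_nat [leRHS]big_nat; apply: ler_sum => m /andP[nm _].
have [b0 be bp] := hb m nm.
apply: (le_trans (meanV_shl_le m Af)).
apply: (le_trans (ler_wpM2l (expR_ge0 _) (bp f Af))).
have g0 : 0 <= meanV (gq (fun x => f x * shl m x)).
  by apply: wmean_ge0 => // x; exact: gam_ge0.
have := ler_wpM2l b0 (mean_transfer_shl Af (leqnn m) kk); have := ler_wpM2r g0 be.
by lra.
Qed.

Lemma bmeas_gam_wker f m : inA mu q f -> bmeas (gam mu (wker q (shl m)) f).
Proof.
move=> Af; have [msh _ _] := cutoff_shl o Edist m.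
apply: (bmeas_gam (measurable_wker mq msh) (wker_ge0 q_ge0 _)).
exact: (inA_wker mq q_ge0 Af (cutoff_shl o Edist m)).
Qed.

Lemma sum_meanV_gam_wker f n N : inA mu q f ->
  \sum_(n <= m < N) meanV (gam mu (wker q (shl m)) f) <= 3 * meanV (gq f).
Proof.
move=> Af; have bgf := bmeas_gam mq q_ge0 Af.
rewrite -(wmean_sum mwV wV_ge0 V_int); last by move=> m; exact: bmeas_gam_wker.
rewrite -(wmeanZ mwV wV_ge0 V_int)//; apply: (le_wmean mwV wV_ge0 V_int).
- by apply: bmeas_sum => m; exact: bmeas_gam_wker.
- exact: bmeasZ.
- by move=> x; exact: sum_gam_wker_shl.
Qed.

(** Only the localised energy returns to [mu_V]. The zero-order terms stay under [mu], still
    carrying [c] and the exponential prefactor, so that a shell Poincaré inequality applies to them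
    once more. *)
Lemma shell_step f (m k : nat) (c eps : R) : inA mu q f -> (k0 <= k)%N ->
  0 <= c -> c * expR (Knk m k) <= eps ->
  c * expR (supV dist o V (m%:R + 2)) * mean1 (gq (fun x => f x * shl m x)) <=
  2 * eps * meanV (gam mu (wker q (shl m)) f) +
  2 * lam * \sum_(i < (2 * k0).+3) c * expR (supV dist o V (m%:R + 2)) *
    mean1 (fun x => (f x * shl (m + i - k0.+1)%N x) ^+ 2).
Proof.
move=> Af kk c0 ce; set S := expR (supV _ _ _ _).
have bw := bmeas_gam_wker m Af.
have w_ge0 x : 0 <= gam mu (wker q (shl m)) f x by apply: gam_ge0; exact: wker_ge0.
have tr : S * mean1 (gam mu (wker q (shl m)) f) <=
    expR (Knk m k) * meanV (gam mu (wker q (shl m)) f).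
  apply: mean_transfer => // x hx.
  apply: (@gam_wker_eq0 _ _ _ dist mu q o Edist k0 range f (m%:R - 1) (m%:R + 2)).
  have kk' : k0%:R <= k%:R :> R by rewrite ler_nat.
  by apply/orP; right; lra.
have bi (i : nat) : bmeas (fun x => (f x * shl i x) ^+ 2) by exact/bmeasX/bmeas_mul_shl.
have h : mean1 (gq (fun x => f x * shl m x)) <= 2 * mean1 (gam mu (wker q (shl m)) f) +
    2 * lam * \sum_(i < (2 * k0).+3) mean1 (fun x => (f x * shl (m + i - k0.+1)%N x) ^+ 2).
  rewrite -(wmean_sum m1 one_ge0 i1)//.
  have bs : bmeas (fun x => \sum_(i < (2 * k0).+3) (f x * shl (m + i - k0.+1)%N x) ^+ 2).
    exact: bmeas_sum.
  rewrite -!(wmeanZ m1 one_ge0 i1)// -(wmeanD m1 one_ge0 i1); [|exact: bmeasZ..].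
  apply: (le_wmean m1 one_ge0 i1); first exact: bmeas_gam_shl.
    by apply: bmeasD; exact: bmeasZ.
  by move=> x; exact: gam_shl_le.
have S0 : 0 <= S := expR_ge0 _.
have W0 : 0 <= meanV (gam mu (wker q (shl m)) f) by exact: wmean_ge0.
rewrite -mulr_sumr; set X := \sum_(i < _) _ in h *.
apply: (le_trans (ler_wpM2l (mulr_ge0 c0 S0) h)); rewrite mulrDr lerD//; last by rewrite mulrCA.
rewrite mulrCA -[leRHS]mulrA ler_wpM2l// -mulrA (le_trans (ler_wpM2l c0 tr))//.
by rewrite mulrA ler_wpM2r.
Qed.

(* An index [j > m] is paid for by the monotonicity of [supV], an index [j <= m] by the
   range of [q]; either way one of the two shell constants is left as a small factor. *)
Lemma double_shell f (b : nat -> R) (n k j m : nat) (eps rs : R) :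
  inA mu q f -> (k0 <= k)%N -> (n <= j)%N -> (n <= m)%N ->
  (forall i, (n <= i)%N ->
    [/\ 0 <= b i, b i * expR (Knk i k) <= eps, shell_poincare i (b i) & b i <= rs]) ->
  b m * expR (supV dist o V (m%:R + 2)) * mean1 (fun x => (f x * shl j x) ^+ 2) <=
  2 * rs * eps * meanV (gq (fun x => f x * shl j x)).
Proof.
move=> Af kk nj nm hb.
have [bm0 bme _ bmr] := hb m nm; have [bj0 bje bjp bjr] := hb j nj.
set S := expR (supV _ _ _ _); have S0 : 0 <= S := expR_ge0 _.
have g0 : 0 <= meanV (gq (fun x => f x * shl j x)).
  by apply: wmean_ge0 => // x; exact: gam_ge0.
have g1 : 0 <= mean1 (gq (fun x => f x * shl j x)).
  by apply: wmean_ge0 => // x; exact: gam_ge0.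
apply: (le_trans (ler_wpM2l (mulr_ge0 bm0 S0) (bjp f Af))).
set X := mean1 _ in g1 *; set Y := meanV _ in g0 *.
(* Common end of both cases: [a] is the shell constant spent against [K], and [c] the one left over
   and bounded by [rs]. *)
have fin (c S' K : R) : 0 <= c -> c <= rs -> S' * X <= K * Y ->
    forall a, 0 <= a -> a * K <= eps -> 2 * (c * (a * (S' * X))) <= 2 * rs * eps * Y.
  move=> c0 cr tr a a0 aK; rewrite -!mulrA ler_wpM2l//.
  have aX : a * (S' * X) <= eps * Y.
    by apply: (le_trans (ler_wpM2l a0 tr)); rewrite mulrA ler_wpM2r.
  apply: (le_trans (ler_wpM2l c0 aX)); rewrite ler_wpM2r//.
  have K0 : 0 <= eps by rewrite (le_trans _ bme)// mulr_ge0 ?expR_ge0.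
  exact: mulr_ge0.
have [jm|/ltnW mj] := leqP j m.
  have := fin _ _ _ bj0 bjr (mean_transfer_shl Af jm kk) _ bm0 bme.
  by rewrite -/S -/X; lra.
have SS : S <= expR (supV dist o V (j%:R + 2)).
  by rewrite ler_expR supV_mono ?lerD2r ?ler_nat// addr_ge0.
have tr := le_trans (ler_wpM2r g1 SS) (mean_transfer_shl Af (leqnn j) kk).
by have := fin _ _ _ bm0 bmr tr _ bj0 bje; lra.
Qed.

(** The sum starts at [n + k0 + 1] so that all neighbours of the shells involved still have index at
    least [n]. The coefficient of the [f^2] term now contains [rs], which can be made small. *)
Lemma outer_bound_small f (b : nat -> R) (n k N : nat) (eps rs : R) :
  inA mu q f -> (k0 <= k)%N ->
  (forall i, (n <= i)%N ->
    [/\ 0 <= b i, b i * expR (Knk i k) <= eps, shell_poincare i (b i) & b i <= rs]) ->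
  \sum_(n + k0.+1 <= m < N) meanV (fun x => (f x * shl m x) ^+ 2) <=
  12 * eps * meanV (gq f) + 8 * lam * rs * eps * ((2 * k0).+3)%:R *
    (6 * meanV (gq f) + 12 * lam * meanV (fun x => f x ^+ 2)).
Proof.
move=> Af kk hb; have [bn0 bne _ bnr] := hb n (leqnn n).
have e0 : 0 <= eps by rewrite (le_trans _ bne)// mulr_ge0 ?expR_ge0.
have rs0 : 0 <= rs := le_trans bn0 bnr.
pose Y j := meanV (gq (fun x => f x * shl j x)).
pose B := 6 * meanV (gq f) + 12 * lam * meanV (fun x => f x ^+ 2).
(* The shell Poincaré inequality gives a factor 2, which multiplies [2 * eps] for the energy, and
   [2 * lam] times [2 * rs * eps] for the neighbours. *)
apply: (@le_trans _ _ (\sum_(n + k0.+1 <= m < N)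
   (4 * eps * meanV (gam mu (wker q (shl m)) f) +
    8 * lam * rs * eps * \sum_(i < (2 * k0).+3) Y (m + i - k0.+1)%N))).
  rewrite big_nat [leRHS]big_nat; apply: ler_sum => m /andP[nm _].
  have nm' : (n <= m)%N by rewrite (leq_trans _ nm)// leq_addr.
  have [bm0 bme bmp _] := hb m nm'.
  have h1 := le_trans (meanV_shl_le m Af) (ler_wpM2l (expR_ge0 _) (bmp f Af)).
  have h2 := shell_step Af kk bm0 bme.
  have h3 : \sum_(i < (2 * k0).+3) b m * expR (supV dist o V (m%:R + 2)) *
      mean1 (fun x => (f x * shl (m + i - k0.+1)%N x) ^+ 2) <=
      2 * rs * eps * \sum_(i < (2 * k0).+3) Y (m + i - k0.+1)%N.
    rewrite mulr_sumr; apply: ler_sum => i _; apply: double_shell hb => //.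
    by move: nm; clear; lia.
  set Z := \sum_(i < _) Y _ in h3 *; apply: (le_trans h1).
  rewrite (mulrCA (expR _)) -(mulrA 2) (mulrA (b m)).
  apply: (le_trans (ler_wpM2l (ler0n R 2) h2)); rewrite mulrDr lerD//.
    by rewrite !mulrA -natrM.
  rewrite (_ : 8 * lam * rs * eps * Z = 2 * (2 * lam * (2 * rs * eps * Z))); last by ring.
  by rewrite ler_wpM2l// ler_wpM2l// mulr_ge0.
rewrite big_split/= -!mulr_sumr lerD//.
  rewrite (_ : 12 * eps * _ = 4 * eps * (3 * meanV (gq f))); last by ring.
  by rewrite ler_wpM2l ?mulr_ge0// sum_meanV_gam_wker.
rewrite -[leRHS]mulrA ler_wpM2l//; first by rewrite mulr_ge0// mulr_ge0// mulr_ge0.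
(* For each fixed offset [i] the inner sum runs over consecutive shells, so the overlap bound
   applies to each of the [2 * k0 + 3] offsets. *)
rewrite exchange_big/= mulr_natl -[X in _ *+ X](card_ord) -sumr_const.
apply: ler_sum => i _; rewrite big_addn.
rewrite (eq_bigr (fun m => Y (m + i)%N)); last first.
  by move=> m _; congr Y; lia.
have -> : \sum_(n <= m < N - k0.+1) Y (m + i)%N =
    \sum_(n + i <= m < N - k0.+1 + i) Y m by rewrite big_addn addnK.
exact: sum_meanV_gam_shl.
Qed.

Lemma super_poincare_inA f (n k : nat) (s r r' : R) : inA mu q f -> (k0 <= k)%N ->
  0 < s -> 0 < r' -> r' <= r -> (epsnk mu dist o V beta n k < +oo)%E ->
  8 * fine (epsnk mu dist o V beta n k) + s * expR (Knk n k) <= r' / (2 + 16 * lam * r') ->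
  meanV (fun x => f x ^+ 2) <= r * meanV (gq f) +
    (1 + 8 * lam * r') * expR (Jnk dist o V n k) * beta s * meanV (fun x => `|f x|) ^+ 2.
Proof.
move=> Af kk s0 r'0 r'r eoo; have [b hb] := shell_constants eoo.
have := epsnk_ge0 n k; move: eoo hb.
set ee := epsnk mu dist o V beta n k => eoo hb ee0 hs.
have eps0 : 0 <= fine ee by rewrite fine_ge0.
have out N : \sum_(n <= m < N) meanV (fun x => (f x * shl m x) ^+ 2) <=
    2 * fine ee * (6 * meanV (gq f) + 12 * lam * meanV (fun x => f x ^+ 2)).
  by apply: (@outer_bound f b n k N) => // j nj; have [] := hb j nj.
have := meanV_sqr_le Af out; have := inner_bound n Af kk s0.
have : 0 <= expR (Jnk dist o V n k) * beta s * meanV (fun x => `|f x|) ^+ 2.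
  by rewrite mulr_ge0 ?sqr_ge0// mulr_ge0 ?expR_ge0// ltW// beta_gt0.
have : 0 <= meanV (gq f) by apply: wmean_ge0 => // x; exact: gam_ge0.
have : 0 <= meanV (fun x => f x ^+ 2) by apply: wmean_ge0 => // x; exact: sqr_ge0.
have : 0 <= s * expR (Knk n k) by rewrite mulr_ge0 ?expR_ge0// ltW.
move: hs eps0; rewrite -(mulrA (1 + 8 * lam * r')) -(mulrA (1 + 8 * lam * r')).
set B := expR _ * _ * _.
move: (fine ee) (s * expR (Knk n k)) (meanV (gq f)) (meanV (fun x => f x ^+ 2)) B
  (meanV (fun x => (f x * tent (- 2) (n%:R + 1) (rho x)) ^+ 2)).
move=> eps t D F B I hs eps0 t0 F0 D0 B0 hI hF.
have L0 : 0 <= lam * r' by rewrite mulr_ge0// ltW.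
have pos : 0 < 2 + 16 * lam * r' by rewrite -mulrA; lra.
move: hs; rewrite ler_pdivlMr// => hs.
have d0 : 0 <= 8 * eps + t by lra.
(* The inner and outer bounds give [2 t + 12 eps] before [D] and [lam] times [2 t + 24 eps] before
   [F]; both are enlarged to multiples of [8 eps + t]. *)
have hF2 : F <= 2 * (8 * eps + t) * D + 16 * lam * (8 * eps + t) * F + B.
  have := mulr_ge0 eps0 D0; have := mulr_ge0 lam0 (mulr_ge0 eps0 F0).
  have := mulr_ge0 lam0 (mulr_ge0 t0 F0); move: hI hF.
  by lra.
have c0 : 0 <= 1 + 8 * (lam * r') by lra.
(* After multiplication by [1 + 8 lam r'], the constraint bounds the coefficient of [D] by [r'] and
   that of [F] on the right by [8 lam r']. Subtracting the latter leaves exactly [F] on the left. *)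
have h1 := ler_wpM2l c0 hF2.
have h2 := ler_wpM2r D0 hs; have h3 := ler_wpM2r (mulr_ge0 lam0 F0) hs.
have h4 := ler_wpM2r D0 r'r.
move: h1 h2 h3 h4.
by lra.
Qed.

(** The mass of [rho > j - 1] tends to 0, so its reciprocal eventually exceeds any given value of
    [beta]. With the last clause of [shell_constants] this makes the shell constants small. *)
Lemma tail_arg_large r : 0 < r -> exists N : nat, forall j : nat, (N <= j)%N ->
  ((beta r)%:E <= tail_arg j)%E.
Proof.
move=> r0; have b0 := beta_gt0 r0.
have B0 : 0 < (2 * beta r)^-1 by rewrite invr_gt0 mulr_gt0.
have [N hN] := @wmean_tail _ _ _ mu _ m1 one_ge0 i1 rho (2 * beta r)^-1
  (measurable_dist Edist o) B0.
exists N.+1 => j Nj; rewrite /Defs.tail_arg.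
set S := [set x | _]; set a := fine (mu S).
have [_|an0] := eqVneq a 0; first exact: leey.
have a1 : 0 < a by rewrite lt_def an0 fine_ge0.
rewrite lee_fin -[leLHS]invrK lef_pV2 ?posrE ?invr_gt0 ?mulr_gt0//.
rewrite -ler_pdivlMl// -invfM.
have mS : measurable S.
  rewrite -[X in measurable X]setTI (_ : S = rho @^-1` `]j%:R - 1, +oo[).
    exact: (measurable_dist Edist o).
  by apply/seteqP; split => x /=; rewrite in_itv/= andbT.
apply: (le_trans _ (hN N (leqnn N))); rewrite /a -mean1_indic//.
apply: (le_wmean m1 one_ge0 i1); [exact: bmeas_indic | exact: (bmeas_ge _ (measurable_dist Edist o)) |].
move=> x; rewrite indicE; have [/set_mem xS|] := boolP (x \in S); last by rewrite ler0n.
have Nx : N%:R <= rho x.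
  have Nj' : N%:R + 1 <= j%:R :> R by rewrite natr1 ler_nat.
  by have : j%:R - 1 < rho x := xS; lra.
by rewrite Nx.
Qed.

Lemma defective_poincare_inA (n k : nat) : (k0 <= k)%N ->
  (epsnk mu dist o V beta n k < +oo)%E ->
  exists C1 C2 : R, [/\ 0 < C1, 0 < C2 & forall f, inA mu q f ->
    meanV (fun x => f x ^+ 2) <= C1 * meanV (gq f) + C2 * meanV (fun x => `|f x|) ^+ 2].
Proof.
move=> kk eoo; have [b hb] := shell_constants eoo.
have := epsnk_ge0 n k; move: eoo hb.
set ee := epsnk mu dist o V beta n k => eoo hb ee0.
have : 0 <= fine ee by rewrite fine_ge0.
move: (fine ee) hb => {ee eoo ee0} eps hb eps0.
pose c : R := ((2 * k0).+3)%:R; have c0 : 0 <= c by [].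
(* [a * rs] is the coefficient of the mean of [f^2] in [outer_bound_small], from [8 * 12 = 96]; the
   choice of [rs] makes it at most 1/4. *)
pose a := 96 * (lam * lam) * eps * c.
have a0 : 0 <= a by rewrite !mulr_ge0.
pose rs := (4 * (a + 1))^-1.
have a1 : 0 < 4 * (a + 1) by lra.
have rs0 : 0 < rs by rewrite invr_gt0.
have ars : a * rs <= 4^-1.
  by rewrite /rs invfM mulrCA ler_piMr ?invr_ge0// ler_pdivrMr ?mul1r; lra.
have [N hN] := tail_arg_large rs0.
pose n1 := maxn n N.
have hb1 i : (n1 <= i)%N ->
    [/\ 0 <= b i, b i * expR (Knk i k) <= eps, shell_poincare i (b i) & b i <= rs].
  rewrite geq_max => /andP[ni Ni]; have [h1 h2 h3 h4] := hb i ni; split=> //.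
  by apply: h4 => //; exact: hN.
pose n2 := (n1 + k0.+1)%N; pose K := expR (Knk n2 k).
have K0 : 0 <= K := expR_ge0 _.
have Kl : 0 <= K * lam by exact: mulr_ge0.
(* The inner bound contributes [2 s K lam], also at most 1/4. Absorbing the total of 1/2 doubles the
   remaining constants [C] and [J]. *)
pose s := (8 * (K * lam + 1))^-1.
have s1 : 0 < 8 * (K * lam + 1) by lra.
have s0 : 0 < s by rewrite invr_gt0.
have sK : s * (K * lam) <= 8^-1.
  by rewrite /s invfM -mulrA ler_piMr ?invr_ge0// mulrC ler_pdivrMr ?mul1r; lra.
pose J := expR (Jnk dist o V n2 k) * beta s.
have J0 : 0 < J by rewrite mulr_gt0 ?expR_gt0 ?beta_gt0.
pose C := 2 * (s * K) + 12 * eps + 48 * (lam * rs * eps * c).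
have sK0 : 0 <= s * K by rewrite mulr_ge0// ltW.
have C0 : 0 <= C.
  have : 0 <= lam * rs * eps * c by rewrite !mulr_ge0// ltW.
  by rewrite /C; lra.
exists (2 * C + 1), (2 * J); split; [by lra | by rewrite mulr_gt0 |].
move=> f Af.
have out M := @outer_bound_small f b n1 k M eps rs Af kk hb1.
have := meanV_sqr_le Af out; have := inner_bound n2 Af kk s0.
have : 0 <= meanV (gq f) by apply: wmean_ge0 => // x; exact: gam_ge0.
have : 0 <= meanV (fun x => f x ^+ 2) by apply: wmean_ge0 => // x; exact: sqr_ge0.
rewrite -/n2 -/K -/J -/c.
move: (meanV (gq f)) (meanV (fun x => f x ^+ 2)) (meanV (fun x => `|f x|))
  (meanV (fun x => (f x * tent (- 2) (n2%:R + 1) (rho x)) ^+ 2)).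
move=> D F G I F0 D0 hI hF.
have h1 := ler_wpM2r F0 ars; have h2 := ler_wpM2r F0 sK.
have -> : (2 * C + 1) * D = 2 * (C * D) + D by ring.
have e1 : 8 * lam * rs * eps * c * (6 * D + 12 * lam * F) =
  48 * (lam * rs * eps * c) * D + a * rs * F by rewrite /a; ring.
have e2 : s * K * (2 * D + 2 * lam * F) = 2 * (s * K) * D + 2 * (s * (K * lam) * F) by ring.
have e3 : C * D = 2 * (s * K) * D + 12 * eps * D + 48 * (lam * rs * eps * c) * D.
  by rewrite /C; ring.
rewrite e1 in hF; rewrite e2 in hI; rewrite e3 -(mulrA 2 J).
move: hF hI h1 h2; move: (a * rs * F) (s * (K * lam) * F) (48 * _ * D) (2 * (s * K) * D)
  (12 * eps * D) (J * G ^+ 2) => x1 x2 x3 x4 x5 x6.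
by lra.
Qed.

End perturbation.

(** * Passage to the closure of the form *)

(** The perturbed bound is what an approximant with squared error [t^2], energy at most [e + t] and
    first absolute moment at most [G + t] provides; the claim is its limit as [t] tends to 0. *)
Lemma le_of_perturbed {R : realType} (F e G C1 C2 : R) : 0 <= C1 -> 0 <= C2 ->
  0 <= e -> 0 <= G ->
  (forall t, 0 < t -> t <= 1 ->
    F <= (1 + t) * (C1 * (e + t) + C2 * (G + t) ^+ 2) + (1 + t^-1) * t ^+ 2) ->
  F <= C1 * e + C2 * G ^+ 2.
Proof.
move=> C10 C20 e0 G0 H; apply/ler_addgt0Pr => d d0.
(* [K] collects the coefficients of the excess terms of the expansion, after [t^2] and [t^3] are
   replaced by [t]. *)
pose K := C1 * e + 2 * C1 + C2 * G ^+ 2 + 4 * (C2 * G) + 2 * C2 + 2.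
have CG : 0 <= C2 * G by exact: mulr_ge0.
have CGG : 0 <= C2 * G ^+ 2 by rewrite mulr_ge0 ?sqr_ge0.
have Ce : 0 <= C1 * e by exact: mulr_ge0.
have K0 : 0 < K by rewrite /K; lra.
pose t := Num.min 1 (d / K).
have t0 : 0 < t by rewrite lt_min ltr01 divr_gt0.
have t1 : t <= 1 by rewrite ge_min lexx.
have tK : t * K <= d by rewrite -ler_pdivlMr// ge_min lexx orbT.
apply: (le_trans (H t t0 t1)).
have -> : (1 + t^-1) * t ^+ 2 = t ^+ 2 + t by rewrite mulrDl mul1r expr2 mulKf ?gt_eqF.
have tt : t ^+ 2 <= t by rewrite expr2 ler_piMr// ltW.
have ttt : t ^+ 3 <= t by rewrite exprS (le_trans (ler_wpM2l (ltW t0) tt))// -expr2.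
have := ler_wpM2l C10 tt; have := ler_wpM2l CG tt; have := ler_wpM2l C20 tt.
have := ler_wpM2l C20 ttt; move: tK tt; rewrite /K.
by lra.
Qed.

Section closure.
Context {R : realType} {dE : measure_display} {E : measurableType dE}.
Context (mu : probability E R) (q : E -> E -> R) (w : E -> R).
Hypothesis mq : measurable_fun setT (fun p : E * E => q p.1 p.2).
Hypothesis q_ge0 : forall x y, 0 <= q x y.
Hypothesis mw : measurable_fun setT w.
Hypothesis w_ge0 : forall x, 0 <= w x.
Hypothesis w1 : (\int[mu]_x (w x)%:E = 1)%E.

Lemma wint_ge0 g : (forall x, 0 <= g x) -> (0 <= wint mu w g)%E.
Proof. by move=> g0; apply: integral_ge0 => x _; rewrite lee_fin mulr_ge0. Qed.

(** Elements of the closure may be unbounded, so comparisons with them are made in the extended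
    reals. *)
Lemma wint_le2 (f g h : E -> R) (a b : R) :
  measurable_fun setT f -> measurable_fun setT g -> measurable_fun setT h ->
  (forall x, 0 <= f x) -> (forall x, 0 <= g x) -> (forall x, 0 <= h x) ->
  0 <= a -> 0 <= b -> (forall x, f x <= a * g x + b * h x) ->
  (wint mu w f <= a%:E * wint mu w g + b%:E * wint mu w h)%E.
Proof.
move=> mf mg mh f0 g0 h0 a0 b0 fgh.
have := @sum_integral_le _ _ _ mu unit [:: tt] (fun _ x => w x * f x)
  (fun x => w x * g x) (fun x => w x * h x) a b.
rewrite big_seq1; apply=> //; try by move=> *; exact: mulr_ge0.
- by move=> _; exact: measurable_funM.
- exact: measurable_funM.
- exact: measurable_funM.
- by move=> x; rewrite big_seq1 mulrCA [b * _]mulrCA -mulrDr ler_wpM2l.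
Qed.

Lemma wint_cst1 : wint mu w (fun=> 1) = 1%E.
Proof. by rewrite /wint; under eq_integral do rewrite mulr1. Qed.

(** [F] and [G] are fixed before [C1] and [C2], so that the same numbers serve the whole family of
    constants over which [betaV] is an infimum. *)
Lemma closure_bound (f : E -> R) (e : R) : closure_val mu q w f e ->
  exists F G : R, [/\ wint mu w (fun x => f x ^+ 2) = F%:E,
    wint mu w (fun x => `|f x|) = G%:E &
    forall C1 C2 : R, 0 <= C1 -> 0 <= C2 ->
      (forall g, inA mu q g -> wmean mu w (fun x => g x ^+ 2) <=
         C1 * wmean mu w (gam mu q g) + C2 * wmean mu w (fun x => `|g x|) ^+ 2) ->
      F <= C1 * e + C2 * G ^+ 2].
Proof.
case=> -[mf f2] [fn [Afn cvD _ cvE]].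
have mf2 : measurable_fun setT (fun x => f x ^+ 2) by exact: measurable_funX.
have mfa : measurable_fun setT (fun x => `|f x|) by exact: measurableT_comp.
have m1 : measurable_fun setT (fun=> 1 : R) := @measurable_cst _ _ E R setT 1.
have sqr0 (g : E -> R) x : 0 <= g x ^+ 2 by exact: sqr_ge0.
have G_lt : (wint mu w (fun x => `|f x|)%R < +oo)%E.
  have h : (wint mu w (fun x => `|f x|)%R <= 1%:E * wint mu w (fun=> 1)%R +
      1%:E * wint mu w (fun x => f x ^+ 2)%R)%E.
    apply: wint_le2 => // x; rewrite !mul1r -(real_normK (num_real (f x))).
    by have := sqr_ge0 (`|f x| - 1); have := normr_ge0 (f x); lra.
  by apply: (le_lt_trans h); rewrite !mul1e wint_cst1 lte_add_pinfty// ltry.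
have Ffin : wint mu w (fun x => f x ^+ 2) \is a fin_num.
  by rewrite ge0_fin_numE ?wint_ge0.
have Gfin : wint mu w (fun x => `|f x|) \is a fin_num.
  by rewrite ge0_fin_numE ?wint_ge0.
exists (fine (wint mu w (fun x => f x ^+ 2))), (fine (wint mu w (fun x => `|f x|))).
split; rewrite ?fineK// => C1 C2 C10 C20 H.
set F := fine _; set G := fine _.
have FE : wint mu w (fun x => f x ^+ 2) = F%:E by rewrite fineK.
have GE : wint mu w (fun x => `|f x|) = G%:E by rewrite fineK.
pose En n := wmean mu w (gam mu q (fn n)).
have EnE n : Eform mu q w (fn n) = (En n)%:E.
  by rewrite EformE// (wintE mw w_ge0 w1)//; exact: bmeas_gam.
have En0 n : 0 <= En n by apply: wmean_ge0 => // x; exact: gam_ge0.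
move: cvE; under eq_fun do rewrite EnE; move=> /fine_cvgP[_ /= cvE].
move: cvD => /fine_cvgP[finD cvD].
have e0 : 0 <= e.
  apply/ler_addgt0Pr => t t0; move/cvgrPdist_le : cvE => /(_ _ t0) /filter_ex[n].
  rewrite /= ler_norml => /andP[h _]; have := En0 n; lra.
have G0 : 0 <= G by rewrite fine_ge0 ?wint_ge0.
apply: le_of_perturbed => // t t0 t1.
have t20 : 0 < t ^+ 2 by rewrite exprn_gt0.
(* The squared error is required below [t^2], so that it stays of order [t] after multiplication by
   [t^-1]. *)
have [n [finDn Dn Enn]] : exists n, [/\ wint mu w (fun x => (fn n x - f x) ^+ 2) \is a fin_num,
   fine (wint mu w (fun x => (fn n x - f x) ^+ 2)) <= t ^+ 2 & En n <= e + t].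
  move/cvgrPdist_le : cvD => /(_ _ t20) cvD; move/cvgrPdist_le : cvE => /(_ _ t0) cvE.
  have [n [h1 [h2 h3]]] := filter_ex (filterI finD (filterI cvD cvE)).
  exists n; split => //.
    by move: h2; rewrite sub0r normrN; apply: le_trans; exact: ler_norm.
  by move: h3; rewrite distrC ler_norml => /andP[_]; rewrite lerBlDl.
have [bg mg] : bmeas (fn n) /\ measurable_fun setT (fn n).
  by have := inA_bmeas (Afn n); split=> //; case: (Afn n).
have mu' : measurable_fun setT (fun x => fn n x - f x) by exact: measurable_funB.
have mu2 : measurable_fun setT (fun x => (fn n x - f x) ^+ 2) by exact: measurable_funX.
have mg2 : measurable_fun setT (fun x => fn n x ^+ 2) by exact: measurable_funX.
set D := fine _ in Dn; have DE : wint mu w (fun x => (fn n x - f x) ^+ 2) = D%:E.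
  by rewrite fineK.
have u20 x : 0 <= (fn n x - f x) ^+ 2 by exact: sqr_ge0.
have tV0 : 0 < t^-1 by rewrite invr_gt0.
have hF : F <= (1 + t) * wmean mu w (fun x => fn n x ^+ 2) + (1 + t^-1) * D.
  rewrite -lee_fin EFinD !EFinM -FE -DE -(wintE mw w_ge0 w1); last exact: bmeasX.
  apply: wint_le2 => //; [by lra | by rewrite addr_ge0// ltW |] => x.
  (* Young's inequality for the cross term of [f = fn n - (fn n - f)], with weight [t]. *)
  have := mulr_ge0 (ltW tV0) (sqr_ge0 (t * fn n x + (fn n x - f x))).
  rewrite (_ : t^-1 * _ = t * fn n x ^+ 2 + 2 * fn n x * (fn n x - f x) +
      t^-1 * (fn n x - f x) ^+ 2); last by field; rewrite gt_eqF.
  by lra.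
have hG : wmean mu w (fun x => `|fn n x|) <= G + t.
  (* By Young's inequality [h] dominates [|fn n - f|], and its mean is at most [t / 2 + t / 2]. *)
  pose h x := t / 2 * 1 + t^-1 / 2 * (fn n x - f x) ^+ 2.
  have mh : measurable_fun setT h by apply: measurable_funD; apply: measurable_funM.
  have h0 x : 0 <= h x by rewrite addr_ge0// mulr_ge0// divr_ge0// ltW.
  have whle : (wint mu w h <= (t / 2 + t^-1 / 2 * D)%:E)%E.
    rewrite EFinD [X in (_ + X)%E]EFinM -DE -[X in (X + _)%E]mule1 -wint_cst1.
    by apply: wint_le2 => //; rewrite divr_ge0// ltW.
  have wh : (wint mu w h <= t%:E)%E.
    apply: (le_trans whle); rewrite lee_fin.
    have := ler_wpM2l (ltW tV0) Dn; rewrite expr2 mulKf ?gt_eqF//; lra.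
  rewrite -lee_fin -(wintE mw w_ge0 w1); last exact: bmeas_norm.
  rewrite EFinD -GE; apply: (@le_trans _ _ (1%:E * wint mu w (fun x => `|f x|)%R + 1%:E * wint mu w h)%E).
    apply: wint_le2 => //; first exact: measurableT_comp.
    move=> x; rewrite !mul1r /h mulr1.
    have hu : `|fn n x - f x| <= t / 2 + t^-1 / 2 * (fn n x - f x) ^+ 2.
      rewrite -(real_normK (num_real (fn n x - f x))); set u := `| _ |.
      have := mulr_ge0 (ltW tV0) (sqr_ge0 (u - t)).
      have -> : t^-1 * (u - t) ^+ 2 = t - 2 * u + t^-1 * u ^+ 2 by field; rewrite gt_eqF.
      by lra.
    have := ler_normD (f x) (fn n x - f x); rewrite addrC subrK; lra.
  by rewrite !mul1e leeD2l.
have g0 : 0 <= wmean mu w (fun x => `|fn n x|) by exact: wmean_ge0.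
apply: (le_trans hF); apply: lerD; last by rewrite ler_wpM2l// addr_ge0// ltW.
rewrite ler_wpM2l//; first by lra.
apply: (le_trans (H _ (Afn n))); rewrite lerD//; first by rewrite ler_wpM2l.
by rewrite ler_wpM2l// lerXn2r// nnegrE// (le_trans g0).
Qed.

End closure.

(** * Passage to the infimum defining [betaV] *)

Section infimum.
Context {R : realType} {dE : measure_display} {E : measurableType dE}.
Context (dist : E -> E -> R) (mu : probability E R) (q : E -> E -> R) (o : E).
Context (V : E -> R) (beta : R -> R) (k0 : nat).
Hypothesis q_ge0 : forall x y, 0 <= q x y.
Hypothesis beta_gt0 : forall r, 0 < r -> 0 < beta r.

(* The bound passes to the infimum because the index set is nonempty, so [betaV] is finite. *)
Lemma le_betaV (r F e G : R) : 0 < r -> inf_eps mu dist o V beta k0 = 0%E ->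
  (forall (n k : nat) (s r' : R), (k0 <= k)%N -> 0 < s -> 0 < r' -> r' <= r ->
    (epsnk mu dist o V beta n k < +oo)%E ->
    8 * fine (epsnk mu dist o V beta n k) + s * expR (Knk dist o V n k) <=
      r' / (2 + 16 * lam dist mu q * r') ->
    F <= r * e + (1 + 8 * lam dist mu q * r') * expR (Jnk dist o V n k) * beta s * G ^+ 2) ->
  (F%:E <= (r * e)%:E + betaV mu dist q o V beta k0 r * G%:E ^+ 2)%E.
Proof.
move=> r0 inf0 bound; have L0 : 0 <= lam dist mu q := lam_ge0 dist mu q_ge0.
rewrite /betaV -/(lam dist mu q); set S := [set y | _].
have S0 y : S y -> (0 <= y)%E.
  move=> [s [r' [n [k [[s0 /andP[r'0 _] _ _] _ ->]]]]]; rewrite lee_fin.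
  rewrite mulr_ge0 ?(ltW (beta_gt0 s0))// mulr_ge0 ?expR_ge0//.
  by rewrite addr_ge0// mulr_ge0 ?(ltW r'0)// mulr_ge0.
have SF y : S y -> (F%:E <= (r * e)%:E + y * G%:E ^+ 2)%E.
  move=> [s [r' [n [k [[s0 /andP[r'0 r'r] _ kk] h ->]]]]].
  have e0 := epsnk_ge0 dist mu o V beta n k.
  have efin : epsnk mu dist o V beta n k \is a fin_num.
    rewrite ge0_fin_numE// ltey; apply/eqP => eoo.
    by move: h; rewrite eoo gt0_muley ?lte_fin// addye// leye_eq.
  rewrite -EFin_expe -EFinM -EFinD lee_fin; apply: bound => //.
    by rewrite -ge0_fin_numE.
  by rewrite -lee_fin EFinD EFinM fineK.
have [y Sy] : S !=set0.
  pose T := r / (2 + 16 * lam dist mu q * r).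
  have T0 : 0 < T by rewrite divr_gt0// ltr_wpDr// mulr_ge0 ?(ltW r0)// mulr_ge0.
  have : (inf_eps mu dist o V beta k0 < (T / 16)%:E)%E by rewrite inf0 lte_fin divr_gt0.
  move=> /ereal_inf_lt[_ [n [k [n1 kk ->]]] hT].
  pose K := expR (Knk dist o V n k); have K0 : 0 < K := expR_gt0 _.
  (* The bound [T] is shared equally: [8 eps < T / 2] by the choice of [n] and [k], and
     [s K = T / 2]. *)
  pose s := T / (2 * K); have s0 : 0 < s by rewrite divr_gt0// mulr_gt0.
  exists ((1 + 8 * lam dist mu q * r) * expR (Jnk dist o V n k) * beta s)%:E.
  exists s, r, n, k; split=> //; first by rewrite r0 lexx.
  have efin : epsnk mu dist o V beta n k \is a fin_num.
    by rewrite ge0_fin_numE ?epsnk_ge0// (lt_trans hT)// ltry.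
  rewrite -(fineK efin) -EFinM -EFinD lee_fin -/T -/K.
  have : s * K = T / 2 by rewrite /s; field; rewrite gt_eqF.
  by move: hT; rewrite -[X in (X < _)%E](fineK efin) lte_fin; lra.
have cfin : ereal_inf S \is a fin_num.
  rewrite ge0_fin_numE; last by apply: le_ereal_inf_tmp => z /S0.
  apply: (@le_lt_trans _ _ y); first exact: ereal_inf_lbound.
  by case: Sy => [s [r' [n [k [_ _ ->]]]]]; exact: ltry.
rewrite -(fineK cfin) -EFin_expe -EFinM -EFinD lee_fin; set c := fine _.
apply/ler_addgt0Pr => d d0.
have G1 : 0 < G ^+ 2 + 1 by rewrite ltr_wpDl ?sqr_ge0.
have de0 : 0 < d / (G ^+ 2 + 1) by rewrite divr_gt0.
have [z Sz zc] : exists2 z, S z & (z < (c + d / (G ^+ 2 + 1))%:E)%E.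
  by apply: ereal_inf_lt; rewrite -(fineK cfin) lte_fin ltrDl.
have := SF z Sz; have := S0 z Sz.
case: z zc {Sz} => // z zc _; rewrite -EFin_expe -EFinM -EFinD lee_fin.
rewrite lte_fin in zc; have := ler_wpM2r (sqr_ge0 G) (ltW zc).
have : d / (G ^+ 2 + 1) * G ^+ 2 <= d.
  by rewrite mulrAC ler_pdivrMr// ler_wpM2l ?(ltW d0)// lerDl.
rewrite mulrDl; lra.
Qed.

End infimum.

(** * Both inequalities on the domain of the closed form *)

Unset Implicit Arguments.

Theorem theorem2p1 (R : realType) (dE : measure_display) (E : measurableType dE)
  (dist : E -> E -> R) (mu : probability E R) (q : E -> E -> R)
  (o : E) (V : E -> R) (beta : R -> R) (k0 : nat) :
  polish dist ->
  measurable_fun setT (fun p : E * E => q p.1 p.2) ->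
  (forall x y, 0 <= q x y) ->
  (forall x, q x x = 0) ->
  (lam_e mu dist q < +oo)%E ->
  (* A is dense in L^2(mu) *)
  (forall f : E -> R, inL2 mu (fun=> 1%R) f -> forall eps : R, 0 < eps ->
     exists2 g, inA mu q g &
       (wint mu (fun=> 1%R) (fun x => (f x - g x) ^+ 2)%R < eps%:E)%E) ->
  (* V *)
  measurable_fun setT V ->
  (forall r : R, exists M : R, forall x, dist o x <= r -> `|V x| <= M) ->
  (\int[mu]_x (expR (V x))%:E = 1)%E ->
  (* beta : (0,oo) -> (0,oo) decreasing *)
  (forall r, 0 < r -> 0 < beta r) ->
  (forall r s, 0 < r -> r <= s -> beta s <= beta r) ->
  (* super Poincare inequality for (E, D(E)) *)
  (forall r : R, 0 < r -> forall (f : E -> R) (e : R),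
     closure_val mu q (fun=> 1%R) f e ->
     (wint mu (fun=> 1%R) (fun x => f x ^+ 2)%R
        <= (r * e)%:E + (beta r)%:E * (wint mu (fun=> 1%R) (fun x => `|f x|)%R) ^+ 2)%E) ->
  (* range condition on q *)
  (1 <= k0)%N ->
  (forall x y, k0%:R < dist x y -> q x y = 0) ->
  (* conclusions *)
  ((inf_eps mu dist o V beta k0 = 0%E ->
     forall r : R, 0 < r -> forall (f : E -> R) (e : R),
       closure_val mu q (wV V) f e ->
       (wint mu (wV V) (fun x => f x ^+ 2)%R
          <= (r * e)%:E + betaV mu dist q o V beta k0 r
                          * (wint mu (wV V) (fun x => `|f x|)%R) ^+ 2)%E)
  /\
   ((inf_eps mu dist o V beta k0 < +oo)%E ->
     exists C1 C2 : R, [/\ 0 < C1, 0 < C2 &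
       forall (f : E -> R) (e : R),
         closure_val mu q (wV V) f e ->
         (wint mu (wV V) (fun x => f x ^+ 2)%R
            <= (C1 * e)%:E + C2%:E * (wint mu (wV V) (fun x => `|f x|)%R) ^+ 2)%E])).
Proof.
move=> Edist mq q_ge0 _ lam_fin _ mV V_bounded V_int beta_gt0 _ spi _ range.
have mwV : measurable_fun setT (wV V) by exact: (measurableT_comp (@measurable_expR R)).
have wV_ge0 x : 0 <= wV V x by exact: expR_ge0.
split=> [inf0 r r0 f e cl | infoo].
  have [F [G [-> -> bound]]] := closure_bound mq q_ge0 mwV wV_ge0 V_int cl.
  apply: le_betaV => // n k s r' kk s0 r'0 r'r eoo hs.
  apply: bound; [exact: ltW | |].
    rewrite mulr_ge0 ?(ltW (beta_gt0 _ s0))// mulr_ge0 ?expR_ge0//.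
    by rewrite addr_ge0// mulr_ge0 ?(ltW r'0)// mulr_ge0// lam_ge0.
  move=> g Ag.
  exact: (super_poincare_inA Edist mq q_ge0 lam_fin mV V_bounded V_int beta_gt0 spi range).
(* A single pair [n], [k] with finite [epsnk] is enough for the defective inequality. *)
have [_ [n [k [_ kk ->]]] eoo] := ereal_inf_lt infoo.
have [C1 [C2 [C10 C20 bound]]] := defective_poincare_inA Edist mq q_ge0 lam_fin mV
  V_bounded V_int beta_gt0 spi range kk eoo.
exists C1, C2; split=> // f e cl.
have [F [G [-> -> cb]]] := closure_bound mq q_ge0 mwV wV_ge0 V_int cl.
rewrite -EFin_expe -EFinM -EFinD lee_fin.
by apply: cb; [exact: ltW | exact: ltW |].
Qed.
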